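(* Let $D$ be the degree sequence of a tree. For every tree $T$ with degree sequence $D$ and every real $x>0$, $$\mathrm{rf}(T,x)\ge \mathrm{rf}(\mathcal G(D),x),$$ with equality if and only if $T$ is isomorphic to $\mathcal G(D)$. In particular, $\mathcal G(D)$ has the smallest total number of rooted spanning forests among all trees with degree sequence $D$.
   Context: For a tree $T$ with $n$ vertices, a $k$-rooted spanning forest of $T$ is a spanning forest of $T$ (a spanning subgraph, obtained by deleting edges) with exactly $k$ components, together with a choice of one root vertex in each component. Let $c_k(T)$ be the number of $k$-rooted spanning forests of $T$, and $\mathrm{rf}(T,x)=\sum_{k=1}^n c_k(T)x^k$. The total number of rooted spanning forests is $\mathrm{rf}(T,1)$. Degree sequences are written in non-increasing order. Greedy tree $\mathcal G(D)$: start with a root $v$ that is assigned the largest degree in $D$. Give $v$ its neighbours $v_1,\dots,v_{d(v)}$ and assign to them the largest available degrees with $d(v_1)\ge d(v_2)\ge\cdots$. Then give $v_1$ its remaining neighbours and assign to them the largest available degrees in non-increasing order; then do the same for $v_2$, $v_3$, etc. Continue in this way, always continuing with the labelled vertex of largest degree whose neighbours are not yet labelled (equivalently, process vertices in breadth-first order, in the order in which they were labelled, always assigning the largest remaining degrees). *)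

(* Defs.v *)
From mathcomp Require Import all_boot all_order all_algebra.
From mathcomp Require Import boolp reals.

Set Implicit Arguments.
Unset Strict Implicit.
Unset Printing Implicit Defensive.

Import Order.TTheory GRing.Theory Num.Theory.
Local Open Scope ring_scope.

(** A graph is an adjacency relation on a finite type of vertices. *)

Definition simple_graph (V : finType) (e : rel V) : Prop :=
  symmetric e /\ irreflexive e.

(* Uniqueness makes [c] a cycle in the graph-theoretic sense; sequences of
   size 1 and 2 are excluded because [cycle e [:: x; y]] only says that [x]
   and [y] are adjacent. *)
Definition acyclic (V : finType) (e : rel V) : Prop :=
  forall c : seq V, (2 < size c)%N -> ~~ ucycleb e c.

Definition is_tree (V : finType) (e : rel V) : Prop :=
  [/\ simple_graph e, (0 < #|V|)%N, (forall x y : V, connect e x y)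
    & acyclic e].

Definition degree (V : finType) (e : rel V) (x : V) : nat :=
  #|[set y | e x y]|.

Definition degree_sequence (V : finType) (e : rel V) : seq nat :=
  sort geq [seq degree e x | x <- enum V].

Definition tree_degree_sequence (D : seq nat) : Prop :=
  exists (V : finType) (e : rel V), is_tree e /\ degree_sequence e = D.

Definition graph_iso (V W : finType) (e : rel V) (e' : rel W) : Prop :=
  exists f : V -> W, bijective f /\ (forall x y : V, e' (f x) (f y) = e x y).

Definition edges (V : finType) (e : rel V) : {set {set V}} :=
  [set [set p.1; p.2] | p : V * V & e p.1 p.2].

Definition adj_of_edges (V : finType) (F : {set {set V}}) : rel V :=
  fun x y => [set x; y] \in F.

Definition components (V : finType) (e : rel V) : {set {set V}} :=
  equivalence_partition (connect e) [set: V].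

(* A pair [FR] consists of the edge set [FR.1] of a spanning subgraph and the
   set [FR.2] of chosen roots, which meets every component in one vertex. *)
Definition rooted_spanning_forests (V : finType) (e : rel V) (k : nat) :
    {set {set {set V}} * {set V}} :=
  [set FR : {set {set V}} * {set V} |
    let comps := components (adj_of_edges FR.1) in
    [&& FR.1 \subset edges e, `[< acyclic (adj_of_edges FR.1) >],
        #|comps| == k & is_transversal FR.2 comps [set: V]]].

Definition rsf_count (V : finType) (e : rel V) (k : nat) : nat :=
  #|rooted_spanning_forests e k|.

Definition rf (R : realType) (V : finType) (e : rel V) (x : R) : R :=
  \sum_(1 <= k < #|V|.+1) (rsf_count e k)%:R * x ^+ k.

(** The greedy tree of a non-increasing sequence [D].  Its vertices are named
    0, 1, 2, ... in the order in which the construction labels them; as the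
    degrees are handed out in non-increasing order, vertex [i] receives the
    [i]-th entry of [D].  The vertices are also processed in this order. *)

(* The number of new neighbours given to [i] when it is processed: every
   vertex but the root is already adjacent to its parent. *)
Definition greedy_new (D : seq nat) (i : nat) : nat :=
  if i == 0%N then nth 0%N D 0 else (nth 0%N D i).-1.

(* The number of vertices labelled just before [i] is processed. *)
Fixpoint greedy_labelled (D : seq nat) (i : nat) : nat :=
  if i is j.+1 then (greedy_labelled D j + greedy_new D j)%N else 1%N.

Definition greedy_child (D : seq nat) (i j : nat) : bool :=
  (greedy_labelled D i <= j < greedy_labelled D i + greedy_new D i)%N.

Definition greedy_tree (D : seq nat) : rel 'I_(size D) :=
  fun i j => greedy_child D i j || greedy_child D j i.
Arguments greedy_tree : clear implicits.

(* Main.v *)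
(** A rooted spanning forest of a tree is the same as a choice, for every
    vertex, of either "root" or a neighbour as parent, such that no edge is
    chosen from both ends.  Let [Z] be the weighted count of these choices and
    [z v] the count of those in which [v] is a root (its weight left out);
    deleting an edge [ua] gives [Z(T) = Z(T-ua) + z_u(T-ua) + z_a(T-ua)], and
    counts factor over unions of components.

    Exchanging a branch at [u] with a branch at [w] then multiplies out to a
    change of [Z] proportional to [(A - B) (k_u - k_w)], and moving a branch
    behaves alike.  Hence in a minimal tree [z u <= z w] implies
    [deg u >= deg w] and [z a <= z b] for all neighbours [a] of [u] off the
    path to [w] and [b] of [w] off the path to [u], strictly if [z u < z w].

    Root a minimal tree at a vertex minimizing [z].  These comparisons make [z]
    monotone along a breadth-first order with siblings sorted by [z], so the
    degrees are non-increasing along it, and the tree is the greedy one.  As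
    this holds for every minimal tree, ties in [z] do no harm and a tree
    attaining the minimum at a single [x] is already greedy. *)

Require Import Defs.
From mathcomp Require Import all_boot all_order all_algebra.
From mathcomp Require Import boolp reals.
From mathcomp Require Import perm zify ring lra.

Set Implicit Arguments.
Unset Strict Implicit.
Unset Printing Implicit Defensive.

Import Order.TTheory GRing.Theory Num.Theory.
Local Open Scope ring_scope.

(** * Acyclic graphs *)

Section AcyclicGraphs.
Variables (V : finType) (e : rel V).
Hypotheses (es : symmetric e) (ei : irreflexive e) (ea : acyclic e).

Definition avoid (a : V) : rel V := [rel x y | [&& e x y, x != a & y != a]].

Lemma avoidE a x y : avoid a x y = [&& e x y, x != a & y != a].
Proof. by []. Qed.

Lemma avoid_sym a : symmetric (avoid a).
Proof. by move=> x y; rewrite !avoidE es; congr (_ && _); rewrite andbC. Qed.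

Lemma path_avoid a x p : a \notin x :: p -> path e x p -> path (avoid a) x p.
Proof.
elim: p x => //= y p IH x; rewrite !inE !negb_or => /and3P[ax ay ap] /andP[xy yp].
by rewrite avoidE xy ![_ == a]eq_sym ax ay IH // inE negb_or ay.
Qed.

Lemma acyclic_avoid x a b : e x a -> e x b -> connect (avoid x) a b -> a = b.
Proof.
move=> xa xb /connectP[p0 pp lp]; case/shortenP: pp lp => p pp up _ lp.
have [//|ab] := eqVneq a b.
have xp : x \notin a :: p.
  have ax : a != x by apply: contraTneq xa => ->; rewrite ei.
  elim: p a pp {up lp ab xa} ax => [|y p IH] a /=; first by rewrite inE eq_sym.
  by case/andP => /and3P[_ _ yx] yp ax; rewrite inE negb_or eq_sym ax IH.
have pe : path e a p by apply: sub_path pp => y z /and3P[].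
have : ucycleb e (x :: a :: p).
  by rewrite /ucycleb (cons_uniq x) xp up andbT /= xa rcons_path pe -lp es xb.
have := @ea (x :: a :: p); rewrite /= => /[swap] -> /(_ _) // H.
by exfalso; suff: false by []; apply: H; case: (p) lp ab => [->|] //=; rewrite eqxx.
Qed.

(** The tails of both paths avoid [x] and end at the same vertex, so [acyclic_avoid] makes the first
    steps agree. *)
Lemma acyclic_path_unique x p q :
  path e x p -> uniq (x :: p) -> path e x q -> uniq (x :: q) ->
  last x p = last x q -> p = q.
Proof.
elim: p x q => [|a p IH] x [|b q] //=.
- by move=> _ _ _ /andP[xq _] E; rewrite {1}E mem_last in xq.
- by move=> _ /andP[xq _] _ _ E; rewrite -{1}E mem_last in xq.
case/andP=> xa pp /andP[xp up] /andP[xb pq] /andP[xq uq] lpq.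
have ab : a = b.
  apply: (acyclic_avoid xa xb).
  apply: (@connect_trans _ _ (last a p)).
    by apply/connectP; exists p => //; apply: path_avoid.
  rewrite (sym_connect_sym (@avoid_sym x)) lpq.
  by apply/connectP; exists q => //; apply: path_avoid.
by rewrite -ab in pq uq lpq *; rewrite (IH a q).
Qed.

(** The parent of [v] is the first vertex after [v] on its unique simple path to [R]. This serves
    both a tree with a single root and a spanning forest with its chosen roots. *)
Lemma forest_parent (R : {set V}) :
  (forall v, exists2 r, r \in R & connect e v r) ->
  {in R &, forall r r', connect e r r' -> r = r'} ->
  exists f : {ffun V -> option V},
  [/\ forall v, (f v == None) = (v \in R),
      forall x y, e x y = (f x == Some y) || (f y == Some x)
    & forall x y, f x = Some y -> f y != Some x].
Proof.
move=> Rex Run.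
have /choice[P PP] : forall v, exists p,
    [/\ path e v p, uniq (v :: p) & last v p \in R].
  move=> v; have [r rR /connectP[p0 pp lp]] := Rex v.
  case/shortenP: pp lp => p pp up _ lp.
  by exists p; split=> //; rewrite -lp.
have PU v p : path e v p -> uniq (v :: p) -> last v p \in R -> P v = p.
  move=> pp up lp; have [pP uP lP] := PP v.
  apply: (acyclic_path_unique pP uP pp up); apply: (Run _ _ lP lp).
  apply: (@connect_trans _ _ v); last by apply/connectP; exists p.
  by rewrite (sym_connect_sym es); apply/connectP; exists (P v).
have Pcons x y p : P x = y :: p -> P y = p /\ x \notin y :: p.
  move=> E; have := PP x; rewrite E /= => -[/andP[_ pp] /andP[xp up] lp].
  by split=> //; apply: PU.
exists [ffun v => ohead (P v)]; split.
- move=> v; rewrite ffunE; apply/idP/idP.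
    by have [_ _] := PP v; case: (P v).
  by move=> vR; rewrite (PU v [::]).
- move=> x y; rewrite !ffunE; apply/idP/idP.
    move=> xy; have [pp up lp] := PP y.
    (* If [x] lies on the path of [y], uniqueness makes it the first step of that path; otherwise
       prepending [y] gives the path of [x]. *)
    have [xp|xp] := boolP (x \in y :: P y).
      apply/orP; right; move: xp; rewrite inE.
      have -> /= : (x == y) = false by apply: contraTF xy => /eqP->; rewrite ei.
      move=> xp; case/splitPr: xp pp up lp => p1 p2 pp up lp.
      have := @acyclic_path_unique y (rcons p1 x) [:: x].
      rewrite -cat_rcons in pp up *; rewrite cat_path in pp.
      rewrite /= last_rcons es xy => ->//.
      + by case/andP: pp.
      + by move: up; rewrite -cat_cons cat_uniq => /andP[].
      + by rewrite inE andbT; apply: contraTneq xy => ->; rewrite ei.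
    by rewrite (PU x (y :: P y)) //= ?eqxx // ?xy // xp.
  case/orP => /eqP.
    by have [] := PP x; case: (P x) => //= z p /andP[+ _] _ _ [<-].
  by have [] := PP y; case: (P y) => //= z p /andP[+ _] _ _ [<-]; rewrite es.
move=> x y; rewrite !ffunE; case E: (P x) => [|z p] //= [zy].
rewrite zy in E; have [-> xp] := Pcons _ _ _ E.
by case: (p) xp => //= w q; rewrite !inE !negb_or => /and3P[_ xw _];
  apply: contraNneq xw => -[->].
Qed.

End AcyclicGraphs.

(** * Parent functions and weighted forests *)

Section ParentFunctions.
Variable V : finType.
Implicit Types (e : rel V) (f g : {ffun V -> option V}) (S C A B : {set V}).

(* Excluding an edge used in both directions is enough to exclude all cycles
   when [e] is acyclic. *)
Definition valid_parents e f : bool :=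
  [forall v, forall y, (f v == Some y) ==> e v y && (f y != Some v)].

Lemma valid_parentsP e f :
  reflect (forall v y, f v = Some y -> e v y /\ f y != Some v) (valid_parents e f).
Proof.
apply: (iffP forallP) => [H v y E|H v].
  by have /forallP/(_ y)/implyP/(_ (introT eqP E))/andP := H v.
by apply/forallP => y; apply/implyP => /eqP/H[-> ->].
Qed.

Definition roots_of f : {set V} := [set v | f v == None].

Definition mix_set C S S' : {set V} := (S :&: C) :|: (S' :\: C).

Definition mix_fun C f g : {ffun V -> option V} :=
  [ffun v => if v \in C then f v else g v].

Lemma in_mix_set C S S' v :
  (v \in mix_set C S S') = if v \in C then v \in S else v \in S'.
Proof. by rewrite !inE; case: (v \in C); rewrite ?andbT ?andbF ?orbF. Qed.

Lemma card_mix_set C S S' :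
  (#|mix_set C S S'| + #|mix_set C S' S| = #|S| + #|S'|)%N.
Proof.
have H A B : #|mix_set C A B| = (#|A :&: C| + #|B :\: C|)%N.
  have I0 : (A :&: C) :&: (B :\: C) = set0.
    by apply/setP => v; rewrite !inE; case: (v \in C); rewrite ?andbF.
  by rewrite cardsU I0 cards0 subn0.
by move: (cardsID C S) (cardsID C S'); rewrite !H; lia.
Qed.

Lemma mix_funK C f g : mix_fun C (mix_fun C f g) (mix_fun C g f) = f.
Proof. by apply/ffunP => v; rewrite !ffunE; case: (v \in C). Qed.

Lemma valid_parents_mix e C f g : (forall x y, e x y -> (x \in C) = (y \in C)) ->
  valid_parents e f -> valid_parents e g -> valid_parents e (mix_fun C f g).
Proof.
move=> eC /valid_parentsP vf /valid_parentsP vg; apply/valid_parentsP => v y.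
rewrite !ffunE; case: ifP => vC E.
  by have [vy fy] := vf _ _ E; rewrite -(eC _ _ vy) vC.
by have [vy fy] := vg _ _ E; rewrite -(eC _ _ vy) vC.
Qed.

Lemma roots_of_mix C f g : roots_of (mix_fun C f g) = mix_set C (roots_of f)
  (roots_of g).
Proof. by apply/setP => v; rewrite in_mix_set !inE ffunE; case: ifP. Qed.

Lemma mix_setD C A B (A' B' : {set V}) :
  mix_set C A B :\: mix_set C A' B' = mix_set C (A :\: A') (B :\: B').
Proof. by apply/setP => v; rewrite inE !in_mix_set; case: ifP; rewrite !inE. Qed.

Lemma sub_mix_set C A B (A' B' : {set V}) :
  A \subset A' -> B \subset B' -> mix_set C A B \subset mix_set C A' B'.
Proof.
move=> /subsetP sA /subsetP sB; apply/subsetP => v; rewrite !in_mix_set.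
by case: ifP => _; [apply: sA|apply: sB].
Qed.

Lemma mix_setK C A B : mix_set C (mix_set C A B) (mix_set C B A) = A.
Proof. by apply/setP => v; rewrite !in_mix_set; case: (v \in C). Qed.

Definition update f (u : V) (o : option V) : {ffun V -> option V} :=
  [ffun v => if v == u then o else f v].

End ParentFunctions.

Section WeightedForests.
Variables (R : realFieldType) (x : R).

(** When [e] is a forest with Laplacian [L], this is the principal minor of [x I + L] obtained by
    deleting the rows and columns in [S]. *)
Definition wforests (V : finType) (e : rel V) (S : {set V}) : R :=
  \sum_(f : {ffun V -> option V} | valid_parents e f && (S \subset roots_of f))
    x ^+ #|roots_of f :\: S|.

Section FixedVertices.
Variable V : finType.
Implicit Types (e : rel V) (S C A B : {set V}).

Lemma wforests_gt0 e S : 0 < x -> 0 < wforests e S.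
Proof.
move=> x0; rewrite /wforests (bigD1 [ffun => None]) /=.
  rewrite ltr_pwDl ?exprn_gt0 //.
  by apply: sumr_ge0 => f _; rewrite exprn_ge0 // ltW.
apply/andP; split; first by apply/valid_parentsP => v y; rewrite ffunE.
by apply/subsetP => v _; rewrite !inE ffunE.
Qed.

(* Exchange the restrictions to [C] of the two parent functions. *)
Lemma wforests_mix e C S S' : (forall x y, e x y -> (x \in C) = (y \in C)) ->
  wforests e S * wforests e S' =
  wforests e (mix_set C S S') * wforests e (mix_set C S' S).
Proof.
move=> eC; rewrite /wforests !big_distrlr /= !pair_big /=.
pose h (p : {ffun V -> option V} * {ffun V -> option V}) :=
  (mix_fun C p.1 p.2, mix_fun C p.2 p.1).
rewrite (reindex_onto h h) /=; last by case=> f g _; rewrite /h /= !mix_funK.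
apply: eq_big => [[f g]|[f g] _] /=.
  rewrite /h /= !mix_funK eqxx andbT.
  have vm f1 f2 : valid_parents e (mix_fun C f1 f2) && valid_parents e (mix_fun C
    f2 f1) =
      valid_parents e f1 && valid_parents e f2.
    apply/idP/idP => /andP[H1 H2]; last by rewrite !valid_parents_mix.
    have := valid_parents_mix eC H2 H1; have := valid_parents_mix eC H1 H2.
    by rewrite !mix_funK => -> ->.
  rewrite andbACA vm [RHS]andbACA; congr (_ && _).
  apply/idP/idP => /andP[s1 s2]; apply/andP; split.
  - by have := sub_mix_set C s1 s2; rewrite !roots_of_mix mix_setK.
  - by have := sub_mix_set C s2 s1; rewrite !roots_of_mix mix_setK.
  - by have := sub_mix_set C s1 s2; rewrite mix_setK -roots_of_mix.
  - by have := sub_mix_set C s2 s1; rewrite mix_setK -roots_of_mix.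
rewrite -!exprD /h /= !roots_of_mix.
congr (_ ^+ _); rewrite -(card_mix_set C (_ :\: mix_set C S S')).
by rewrite -!mix_setD !mix_setK.
Qed.

(** Factorization over [C] and its complement, as an instance of the exchange on [C]. The
    cross-multiplied form keeps all counts on the same vertex type. *)
Lemma wforests_factor e C S a : (forall x y, e x y -> (x \in C) = (y \in C)) ->
  a \in C -> [disjoint S & C] ->
  wforests e (a |: S) * wforests e set0 = wforests e [set a] * wforests e S.
Proof.
move=> eC aC dSC; rewrite (wforests_mix _ _ eC); congr (_ * _);
  congr wforests; apply/setP => v; rewrite in_mix_set !inE.
  case: ifP => [vC|/negbT vC].
    by rewrite (disjointFl dSC vC) orbF.
  by apply/esym; apply: contraNF vC => /eqP->.
case: ifP => [vC|/negbT vC]; first by rewrite (disjointFl dSC vC).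
by have [va|] //= := eqVneq v a; rewrite va aC in vC.
Qed.

(** The terms count the forests that do not use the edge, those where [a] is the parent of [u], and
    those where [u] is the parent of [a]. Cutting the edge turns the child into a root that carries
    no weight, like the members of [S]; a child already in [S] is impossible. *)
Lemma wforests_edge e e0 u a S : u != a -> ~~ e0 u a -> ~~ e0 a u ->
  (forall y z, e y z = [|| e0 y z, (y == u) && (z == a) | (y == a) && (z == u)]) ->
  wforests e S = wforests e0 S +
    (if u \in S then 0 else wforests e0 (u |: S)) +
    (if a \in S then 0 else wforests e0 (a |: S)).
Proof.
move=> ua n1 n2 E.
have oriented (u1 a1 : V) : u1 != a1 -> ~~ e0 u1 a1 -> ~~ e0 a1 u1 ->
  (forall y z, e y z =
     [|| e0 y z, (y == u1) && (z == a1) | (y == a1) && (z == u1)]) ->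
  \sum_(f | [&& valid_parents e f, S \subset roots_of f & f u1 == Some a1])
      x ^+ #|roots_of f :\: S| =
    (if u1 \in S then 0 else wforests e0 (u1 |: S)).
  move: u1 a1 {u a ua n1 n2 E} => u a ua n1 n2 E.
  have [uS|uS] := boolP (u \in S).
    apply: big_pred0 => f; apply/and3P => -[_ /subsetP/(_ _ uS)].
    by rewrite inE => /eqP->.
  (* The correspondence cuts the edge above [u] in one direction and restores it in the other. *)
  rewrite (reindex_onto (fun g => update g u (Some a)) (fun f => update f u None)).
    2: by move=> f /and3P[_ _ /eqP fu]; apply/ffunP => v; rewrite !ffunE;
          case: eqP => // ->.
  apply: eq_big => [g|g _]; last first.
    congr (_ ^+ _); apply: eq_card => v; rewrite !inE ffunE negb_or.
    by case: (v == u); rewrite /= ?andbF.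
  have -> : (update (update g u (Some a)) u None == g) = (g u == None).
    apply/eqP/eqP => [<-|gu]; first by rewrite ffunE eqxx.
    by apply/ffunP => v; rewrite !ffunE; case: eqP => // ->.
  rewrite subUset sub1set inE [update _ _ _ u]ffunE !eqxx andbT.
  have [gu|] := eqVneq (g u) None; last by rewrite !andbF.
  rewrite !andbT /=; congr (_ && _).
    apply/valid_parentsP/valid_parentsP => H v y.
      move=> gv; have vu : v != u by apply/eqP => vu; rewrite vu gu in gv.
      have := H v y; rewrite !ffunE (negbTE vu) gv => /(_ erefl)[].
      rewrite E (negbTE vu) /=; case: (eqVneq y u) => [->|yu].
        rewrite gu andbT; case: (eqVneq v a) => [->|_]; first by rewrite eqxx.
        by rewrite orbF.
      by rewrite andbF orbF.
    rewrite !ffunE; case: eqP => [->|_].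
      case=> <-; rewrite E !eqxx orbT (eq_sym a) (negbTE ua); split=> //.
      by apply: contra n2 => /eqP/H[].
    move=> gv; have [vy gy] := H _ _ gv; rewrite E vy; split=> //.
    case: (eqVneq y u) => // yu; apply: contra n2 => /eqP[->].
    by rewrite -yu.
  apply/subsetP/subsetP => H v vS; have := H _ vS; rewrite !inE ffunE;
    case: (eqVneq v u) => // vu; by rewrite vu (negbTE uS) in vS.
rewrite {1}/wforests (bigID (fun f : {ffun V -> option V} => f u == Some a)) /=.
rewrite [X in _ + X](bigID (fun f : {ffun V -> option V} => f a == Some u)) /=.
have -> : \sum_(f | (valid_parents e f && (S \subset roots_of f)) && (f u == Some
  a))
    x ^+ #|roots_of f :\: S| = if u \in S then 0 else wforests e0 (u |: S).
  by rewrite -(oriented u a) //; apply: eq_bigl => f; rewrite andbA.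
have -> : \sum_(f | ((valid_parents e f && (S \subset roots_of f)) && (f u != Some
  a))
    && (f a == Some u)) x ^+ #|roots_of f :\: S| =
    if a \in S then 0 else wforests e0 (a |: S).
  rewrite -(oriented a u) // 1?eq_sym //; last first.
    by move=> y z; rewrite E; congr (_ || _); rewrite orbC.
  (* A valid function never uses the edge from both ends, so [f a = Some u] already excludes
     [f u = Some a]. *)
  apply: eq_bigl => f; rewrite -!andbA; case: valid_parentsP => //= vf.
  have [/vf[_ /negbTE->]|_] := eqVneq (f u) (Some a); first by rewrite !andbF.
  by [].
rewrite addrCA addrC [X in X + _]addrC; congr (_ + _ + _).
apply: eq_bigl => f; rewrite -!andbA.
apply/idP/idP => [/and4P[/valid_parentsP vf -> fu fa]|/andP[/valid_parentsP vf ->]].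
  rewrite andbT; apply/valid_parentsP => v y fv; have [vy fy] := vf _ _ fv.
  split=> //; move: vy; rewrite E => /or3P[//|/andP[/eqP vu /eqP ya]|].
    by rewrite -vu fv ya eqxx in fu.
  by case/andP=> /eqP va /eqP yu; rewrite -va fv yu eqxx in fa.
apply/and4P; split=> //; first by apply/valid_parentsP => v y /vf[vy]; rewrite E vy.
  by apply: contra n1 => /eqP/vf[].
by apply: contra n2 => /eqP/vf[].
Qed.

End FixedVertices.

End WeightedForests.

(** * Trees given by a parent map *)

Section RootedTrees.
Variable V : finType.
Implicit Types (par : V -> V) (r u v w a b : V).

Definition rooted par r : Prop := par r = r /\ forall v, fconnect par v r.

(* Every fixed point of [par] is the root of a component, so
   [reparent par a a] detaches the branch at [a]. *)
Definition par_rel par : rel V :=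
  fun v w => (v != w) && ((par v == w) || (par w == v)).

Definition reparent par a u : V -> V := fun v => if v == a then u else par v.

Lemma fconnect_step par v a : v != a -> fconnect par v a = fconnect par (par v) a.
Proof.
move=> va; apply/idP/idP => [|H].
  by case/connectP => -[|y p] /= => [_ E|/andP[/eqP-> pp] E];
    [rewrite E eqxx in va|apply/connectP; exists p].
exact: connect_trans (fconnect1 _ _) H.
Qed.

Lemma fconnect_fix par r v : par r = r -> fconnect par r v -> v = r.
Proof.
by move=> pr /iter_findex <-; elim: (findex _ _ _) => //= n ->.
Qed.

Lemma fconnect_ind par r (P : V -> Prop) :
  (forall v, fconnect par v r) -> P r ->
  (forall v, v != r -> P (par v) -> P v) -> forall v, P v.
Proof.
move=> rr Pr H v; move: (findex par v r) (iter_findex (rr v)) => n.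
elim: n v => [|n IH] v; first by move=> /= ->.
by rewrite iterSr => /IH; have [->|/H] := eqVneq v r.
Qed.

(** [findex par v r] is the depth of [v]. Its strict decrease towards the root gives antisymmetry of
    the ancestor relation and excludes cycles. *)
Lemma depth_lt par r v w : rooted par r -> fconnect par v w -> v != w ->
  (findex par w r < findex par v r)%N.
Proof.
case=> pr rr /iter_findex; move: (findex par v w) => n; elim: n v => [|n IH] v /=.
  by move=> ->; rewrite eqxx.
rewrite -iterS iterSr => E vw.
have vr : v != r.
  apply: contra_neqN vw => /eqP vr; rewrite vr in E *.
  by rewrite -E -iterSr; elim: (n.+1) => //= m <-.
rewrite [findex par v r]fconnect_findex 1?eq_sym // ltnS.
by have [->//|/(IH _ E)/ltnW] := eqVneq (par v) w.
Qed.

Lemma fconnect_anti par r v w : rooted par r ->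
  fconnect par v w -> fconnect par w v -> v = w.
Proof.
move=> rt vw wv; have [//|ne] := eqVneq v w.
have := depth_lt rt vw ne; have := depth_lt rt wv.
by rewrite eq_sym ne => /(_ isT); lia.
Qed.

Lemma par_neq par r v : rooted par r -> v != r -> par v != v.
Proof.
move=> [pr rr] vr; apply: contraNneq vr => E.
by rewrite (fconnect_fix E (rr v)).
Qed.

Lemma par2_neq par r v : rooted par r -> v != r -> par (par v) != v.
Proof.
move=> rt vr; have := par_neq rt vr; apply: contraNneq => E.
by rewrite -[in X in X == _](fconnect_anti rt (fconnect1 par v)) // -{2}E fconnect1.
Qed.

Lemma par_rel_sym par : symmetric (par_rel par).
Proof. by move=> v w; rewrite /par_rel eq_sym orbC. Qed.

Lemma par_rel_irr par : irreflexive (par_rel par).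
Proof. by move=> v; rewrite /par_rel eqxx. Qed.

Lemma par_rel_par par r v : rooted par r -> v != r -> par_rel par v (par v).
Proof. by move=> rt /(par_neq rt); rewrite /par_rel eq_sym eqxx => ->. Qed.

Lemma connect_par_rel par v w : fconnect par v w -> connect (par_rel par) v w.
Proof.
move/iter_findex <-; elim: (findex par v w) => //= n IH.
apply: connect_trans IH _; set y := iter n par v.
have [<-//|ne] := eqVneq y (par y).
by apply: connect1; rewrite /par_rel ne eqxx.
Qed.

Lemma par_rel_tree par r : rooted par r -> is_tree (par_rel par).
Proof.
move=> rt; have [pr rr] := rt; split.
- by split; [exact: par_rel_sym|exact: par_rel_irr].
- by apply/card_gt0P; exists r.
- move=> v w; apply: (@connect_trans _ _ r); first exact: connect_par_rel.
  by rewrite (sym_connect_sym (@par_rel_sym par)) connect_par_rel.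
(* At a deepest vertex of a cycle, both neighbours on the cycle would have to be its parent, hence
   equal. *)
move=> c sc; apply/negP => /andP[cc uc].
have [v0 v0c] : exists v, v \in c by case: c sc {cc uc} => // v c; exists v;
  rewrite inE eqxx.
have [v vc vmax] := arg_maxnP (fun v => findex par v r) v0c.
case/rot_to: vc => i c' E; have := rot_uniq i c;
  have := rot_cycle i (par_rel par) c.
have := size_rot i c; rewrite E uc cc => sz.
case: c' E sz => [|y c'] E; first by move=> sz; rewrite -sz in sc.
case/lastP: c' E => [|c' z] E; first by move=> sz; rewrite -sz in sc.
rewrite /= !rcons_path last_rcons => _ /and3P[vy _ zv] /and3P[_ yz _].
have mc t : t \in v :: y :: rcons c' z -> (findex par t r <= findex par v r)%N.
  by rewrite -E mem_rot; apply: vmax.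
have up t : par_rel par v t -> t \in v :: y :: rcons c' z -> par v = t.
  case/andP=> vt /orP[/eqP//|/eqP tv] /mc; rewrite leqNgt.
  by rewrite (depth_lt rt) // -?tv ?fconnect1 // tv eq_sym.
have yv := up _ vy; have zv' : par v = z.
  by apply: up; rewrite ?inE ?mem_rcons ?inE ?eqxx ?orbT // par_rel_sym.
by move: yz; rewrite -zv' yv ?inE ?mem_rcons ?inE eqxx ?orbT.
Qed.

Lemma reparentC par a b u w : a != b ->
  reparent (reparent par a u) b w = reparent (reparent par b w) a u.
Proof.
move=> ab; apply: funext => v; rewrite /reparent; case: eqP => // ->.
by rewrite eq_sym (negbTE ab).
Qed.

Lemma reparentK par a u : reparent (reparent par a a) a u = reparent par a u.
Proof. by apply: funext => v; rewrite /reparent; case: eqP. Qed.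

Lemma reparent_id par a : reparent par a (par a) = par.
Proof. by apply: funext => v; rewrite /reparent; case: eqP => // ->. Qed.

End RootedTrees.

(** * Moving and exchanging branches *)

Section Attach.
Variables (R : realFieldType) (x : R) (x_gt0 : 0 < x) (V : finType).
Implicit Types (par : V -> V) (r u v w a b p q : V) (S C Ca Cb : {set V}) (A B : R).

Local Notation wf par S := (wforests x (par_rel par) S).

(* The branch at the root [a] enters the counts only through [A], the diagonal
   entry at [a] of the inverse of [x I + L], [L] the Laplacian of that branch. *)
Definition pendant par C a A : Prop :=
  forall S, {in C, forall v, v \notin S} -> wf par (a |: S) = A * wf par S.

(** [C] is a union of components, so by [wforests_factor] forcing [a] to be a root multiplies the
    count by the same ratio whatever is forced off [C]. *)
Lemma pendant_closed par C a : a \in C ->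
  (forall v, v != par v -> (v \in C) = (par v \in C)) ->
  exists2 A, 0 < A & pendant par C a A.
Proof.
move=> aC Cc; exists (wf par [set a] / wf par set0).
  by rewrite divr_gt0 ?wforests_gt0.
move=> S dS; have k0 : wf par set0 != 0 by rewrite lt0r_neq0 ?wforests_gt0.
apply: (mulIf k0); rewrite (@wforests_factor _ _ _ _ C) //.
- by rewrite mulrAC divfK.
- move=> v w /andP[vw] /orP[] /eqP E; first by rewrite Cc E.
  by rewrite (Cc w) E // eq_sym.
- by rewrite disjoint_sym; apply/pred0P => v /=; apply/andP => -[/dS/negP].
Qed.

Section AttachOne.
Variables (par : V -> V) (a p : V).
Hypotheses (pa : par a = a) (ap : a != p) (ppa : par p != a).

Lemma wforests_attach S : wf (reparent par a p) S = wf par S +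
  (if p \in S then 0 else wf par (p |: S)) +
  (if a \in S then 0 else wf par (a |: S)).
Proof.
apply: wforests_edge; rewrite 1?eq_sym //.
- by rewrite /par_rel eq_sym ap /= negb_or ppa pa ap.
- by rewrite /par_rel ap /= negb_or ppa pa ap.
move=> y z; rewrite /par_rel /reparent.
have [->|ya] := eqVneq y a; have [->|za] := eqVneq z a;
  rewrite ?eqxx ?andbF ?orbF //=.
- by rewrite (negbTE ap).
- by rewrite pa (eq_sym a) (negbTE za) (eq_sym p) orbC.
- by rewrite ya /= pa (eq_sym a) (negbTE ya) orbF andbT (eq_sym p).
Qed.

Variables (C : {set V}) (A : R).
Hypotheses (aC : a \in C) (pC : p \notin C) (pen : pendant par C a A).

Let disj_p S : {in C, forall v, v \notin S} -> {in C, forall v, v \notin p |: S}.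
Proof.
by move=> dS v vC; rewrite !inE negb_or dS // andbT; apply: contraNneq pC => <-.
Qed.

Lemma wforests_attach_off S : {in C, forall v, v \notin S} ->
  wf (reparent par a p) S =
  (1 + A) * wf par S + (if p \in S then 0 else wf par (p |: S)).
Proof.
move=> dS; rewrite wforests_attach (negbTE (dS _ aC)) pen //; ring.
Qed.

Lemma wforests_attach_on S : {in C, forall v, v \notin S} ->
  wf (reparent par a p) (a |: S) =
  A * (wf par S + (if p \in S then 0 else wf par (p |: S))).
Proof.
move=> dS; rewrite wforests_attach !inE eqxx /= eq_sym (negbTE ap) /= addr0.
rewrite pen // setUCA; case: ifP => _; first by rewrite !addr0.
by rewrite pen ?mulrDr //; apply: disj_p.
Qed.

End AttachOne.

(** Every term of [wforests_attach] scales by [B], since [a] and [p] lie off [C]. Hence two branches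
    can be attached one after the other. *)
Lemma pendant_attach par a p b C B : par a = a -> a != p -> par p != a ->
  b \in C -> a \notin C -> p \notin C ->
  pendant par C b B -> pendant (reparent par a p) C b B.
Proof.
move=> pa ap ppa bC aC pC pen S dS; rewrite !wforests_attach //.
have dq q : q \notin C -> {in C, forall v, v \notin q |: S}.
  by move=> qC v vC; rewrite !inE negb_or dS // andbT; apply: contraNneq qC => <-.
have bq q : q \notin C -> (q \in b |: S) = (q \in S).
  by move=> qC; rewrite !inE; case: eqP => // qb; rewrite qb bC in qC.
rewrite !bq // pen // !mulrDr ![_ |: (b |: S)]setUCA.
by congr (_ + _ + _); case: ifP => _; rewrite ?mulr0 // pen //; apply: dq.
Qed.

(** The hypothesis reads [(1 + B) * ku + kuw <= (1 + B) * kw], so [ku < kw] because [kuw] is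
    positive, and the two counts differ by [kw - ku]. The second conclusion allows the move to be
    repeated. *)
Lemma wforests_move par u w b C B : 0 < B -> b \in C -> u \notin C -> w \notin C ->
  u != w -> par b = b -> par u != b -> par w != b -> pendant par C b B ->
  let T := reparent par b w in let T' := reparent par b u in
  wf T [set u] <= wf T [set w] ->
  wf T' set0 < wf T set0 /\ wf T' [set u] <= wf T' [set w].
Proof.
move=> B0 bC uC wC uw pb pub pwb pen /=.
have bu : b != u by apply: contraNneq uC => <-.
have bw : b != w by apply: contraNneq wC => <-.
have d0 : {in C, forall v, v \notin (set0 : {set V})} by move=> v _; rewrite inE.
have d1 q : q \notin C -> {in C, forall v, v \notin [set q]}.
  by move=> qC v vC; rewrite inE; apply: contraNneq qC => <-.
have offw := wforests_attach_off pb bw pwb bC pen.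
have offu := wforests_attach_off pb bu pub bC pen.
rewrite !(offw _ (d1 _ _)) // !(offu _ (d1 _ _)) // offw // offu //.
rewrite !inE !eqxx [w == u]eq_sym (negbTE uw) !setU0 [w |: [set u]]setUC !addr0.
have := wforests_gt0 (par_rel par) (u |: [set w]) x_gt0.
set k := wf _ _; set ku := wf _ [set u]; set kw := wf _ [set w]; set kuw := wf _ _.
move=> kuw0 H.
have : ku < kw by rewrite -subr_gt0; nra.
by split; nra.
Qed.

(** All relevant counts become polynomials in [A], [B] and the four counts of the detached forest
    with a subset of [p], [q] forced to be roots. *)
Lemma wforests_attach2 par a p b q Ca Cb A B :
  a \in Ca -> b \notin Ca -> p \notin Ca -> q \notin Ca ->
  b \in Cb -> a \notin Cb -> p \notin Cb -> q \notin Cb ->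
  p != q -> par a = a -> par b = b ->
  par p != a -> par q != b -> pendant par Ca a A -> pendant par Cb b B ->
  let T := reparent (reparent par a p) b q in
  let k S := wf par S in
  [/\ wf T set0 = (1 + B) * ((1 + A) * k set0 + k [set p]) +
                   ((1 + A) * k [set q] + k [set p; q]),
      wf T [set p] = (1 + A) * ((1 + B) * k [set p] + k [set p; q]),
      wf T [set q] = (1 + B) * ((1 + A) * k [set q] + k [set p; q]),
      wf T [set a] = A * ((1 + B) * (k set0 + k [set p]) + k [set q] + k [set p; q])
    & wf T [set b] = B * ((1 + A) * (k set0 + k [set q]) + k [set p] + k [set p;
      q])].
Proof.
move=> aCa bCa pCa qCa bCb aCb pCb qCb pq pa pb ppa pqb penA penB /=.
have ap : a != p by apply: contraNneq pCa => <-.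
have aq : a != q by apply: contraNneq qCa => <-.
have bp : b != p by apply: contraNneq pCb => <-.
have bq : b != q by apply: contraNneq qCb => <-.
have ba : b != a by apply: contraNneq bCa => ->.
have d0 C : {in C, forall v, v \notin (set0 : {set V})} by move=> v _; rewrite inE.
have d1 C t : t \notin C -> {in C, forall v, v \notin [set t]}.
  by move=> tC v vC; rewrite inE; apply: contraNneq tC => <-.
have d2 C t t' : t \notin C -> t' \notin C -> {in C, forall v,
  v \notin t |: [set t']}.
  move=> tC t'C v vC; rewrite !inE negb_or; apply/andP.
  by split; [apply: contraNneq tC => <-|apply: contraNneq t'C => <-].
have pen1 : pendant (reparent par a p) Cb b B by apply: pendant_attach.
have pb1 : reparent par a p b = b by rewrite /reparent (negbTE ba).
have pq1 : reparent par a p q != b by rewrite /reparent ifN // eq_sym.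
have qp : q != p by rewrite eq_sym.
have on := wforests_attach_on pa ap ppa pCa penA.
have off := wforests_attach_off pa ap ppa aCa penA.
have on1 := wforests_attach_on pb1 bq pq1 qCb pen1.
have off1 := wforests_attach_off pb1 bq pq1 bCb pen1.
split.
- rewrite (off1 _ (d0 _)) (off _ (d0 _)) !inE !setU0 (off _ (d1 _ _ qCa)).
  by rewrite inE (negbTE pq); ring.
- rewrite (off1 _ (d1 _ _ pCb)) !inE (negbTE qp) (off _ (d1 _ _ pCa)).
  rewrite (off _ (d2 _ _ _ qCa pCa)) !inE !eqxx orbT [q |: [set p]]setUC; ring.
- rewrite (off1 _ (d1 _ _ qCb)) inE eqxx (off _ (d1 _ _ qCa)) inE (negbTE pq); ring.
- rewrite (off1 _ (d1 _ _ aCb)) inE (eq_sym q) (negbTE aq) setUC.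
  rewrite (on _ (d1 _ _ qCa)) -[[set a]]setU0 (on _ (d0 _)) !inE (negbTE pq)
    !setU0; ring.
- rewrite -[[set b]]setU0 (on1 _ (d0 _)) inE !setU0 (off _ (d0 _)) inE setU0.
  rewrite (off _ (d1 _ _ qCa)) inE (negbTE pq); ring.
Qed.

(* The counts of [T'] and [T] differ by [(A - B) (k u - k w)], where [k]
   refers to the forest with both branches detached. *)
Lemma wforests_swap par u w a b Ca Cb A B : 0 < A -> 0 < B ->
  a \in Ca -> b \notin Ca -> u \notin Ca -> w \notin Ca ->
  b \in Cb -> a \notin Cb -> u \notin Cb -> w \notin Cb ->
  u != w -> par a = a -> par b = b ->
  par u != a -> par w != a -> par u != b -> par w != b ->
  pendant par Ca a A -> pendant par Cb b B ->
  let T := reparent (reparent par a u) b w in let T' :=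
    reparent (reparent par a w) b u in
  wf T [set u] <= wf T [set w] ->
  wf T [set b] < wf T [set a] \/
  wf T [set u] < wf T [set w] /\ wf T [set b] <= wf T [set a] ->
  wf T' set0 < wf T set0.
Proof.
move=> A0 B0 aCa bCa uCa wCa bCb aCb uCb wCb uw pa pb pua pwa pub pwb penA penB T
  T'.
have wu : w != u by rewrite eq_sym.
rewrite /T /T'.
have [-> -> -> -> ->] := wforests_attach2 aCa bCa uCa wCa bCb aCb uCb wCb uw pa pb
  pua pwb penA penB.
have [-> _ _ _ _] := wforests_attach2 aCa bCa wCa uCa bCb aCb wCb uCb wu pa pb pwa
  pub penA penB.
rewrite [[set w; u]]setUC.
have k_gt0 := wforests_gt0 (par_rel par) _ x_gt0.
move: (k_gt0 set0) (k_gt0 [set u]) (k_gt0 [set w]) (k_gt0 [set u; w]).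
set k := wf _ _; set ku := wf _ [set u]; set kw := wf _ [set w]; set kuw := wf _ _.
move=> k0 ku0 kw0 kuw0 H1 H2.
(* This is [wf T [set w] - wf T [set u]] in expanded form. *)
pose h := (1 + A) * (1 + B) * (kw - ku) + (B - A) * kuw.
have h0 : 0 <= h by rewrite -subr_ge0 in H1; rewrite /h; nra.
(* If [A <= B], the identity [E] writes a positive multiple of [zb - za] as a sum of nonnegative
   terms, one of them positive when [h] is; either way [H2] fails. *)
have AB : B < A.
  rewrite ltNge -subr_ge0; apply/negP => AB.
  pose zb := B * ((1 + A) * (k + kw) + ku + kuw).
  pose za := A * ((1 + B) * (k + ku) + kw + kuw).
  have E : (1 + A) * (1 + B) * (zb - za) =
      (B - A) * ((1 + A) * (1 + B) * (k + kw + ku) + (1 + A + B) * kuw) + A * B * h.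
    by rewrite /zb /za /h; ring.
  have D : 0 < (1 + A) * (1 + B) by rewrite mulr_gt0 // addr_gt0.
  have F : 0 <= (B - A) * ((1 + A) * (1 + B) * (k + kw + ku) + (1 + A + B) * kuw).
    by rewrite mulr_ge0 // addr_ge0 ?mulr_ge0 ?addr_ge0 ?ltW.
  have ABh : 0 <= A * B * h by rewrite !mulr_ge0 // ltW.
  case: H2 => [H2|[H1' H2]].
    have : 0 <= (1 + A) * (1 + B) * (zb - za) by rewrite E addr_ge0.
    by rewrite pmulr_rge0 // subr_ge0 leNgt H2.
  have h1 : 0 < h by rewrite -subr_gt0 in H1'; rewrite /h; nra.
  have : 0 < (1 + A) * (1 + B) * (zb - za) by rewrite E ltr_wpDl // !mulr_gt0.
  by rewrite pmulr_rgt0 // subr_gt0 ltNge H2.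
(* Only [h] is known to be nonnegative; the positive term [(A - B) * kuw] makes up the
   difference. *)
have uw_lt : 0 < kw - ku.
  have : 0 < (1 + A) * (1 + B) * (kw - ku).
    have -> : (1 + A) * (1 + B) * (kw - ku) = h + (A - B) * kuw by rewrite /h; ring.
    by rewrite ltr_wpDl // mulr_gt0 // subr_gt0.
  by rewrite pmulr_rgt0 // mulr_gt0 // addr_gt0.
have : 0 < (A - B) * (kw - ku) by rewrite mulr_gt0 // subr_gt0.
rewrite -subr_gt0 => E; rewrite -subr_gt0; move: E.
by congr (0 < _); ring.
Qed.

End Attach.

(** * Following parents to a root *)

Section Reach.
Variables (V : finType) (e : rel V).
Hypotheses (ei : irreflexive e) (ea : acyclic e).

(** Roots become fixed points, as in [rooted]. *)
Definition step (f : {ffun V -> option V}) : V -> V := fun v => odflt v (f v).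

(* A vertex of smallest forward orbit under [step f] lies on a cycle of it. *)
Lemma reach_root f v : valid_parents e f ->
  exists2 r, f r = None & fconnect (step f) v r.
Proof.
move=> /valid_parentsP vf.
have [y vy ymin] := arg_minnP (fun y =>
  order (step f) y) (connect0 (frel (step f)) v).
exists y => //; case fy: (f y) => [z|] //; exfalso.
have sy : step f y = z by rewrite /step fy.
have sub : fconnect (step f) (step f y) \subset fconnect (step f) y.
  by apply/subsetP => t; apply: connect_trans (fconnect1 _ _).
have /(orbitPcycle 1 0) cyc : order (step f) (step f y) = order (step f) y.
  apply/eqP; rewrite eqn_leq ymin ?(connect_trans vy (fconnect1 _ _)) // andbT.
  exact: subset_leq_card.
have yo : y \in orbit (step f) y by rewrite -fconnect_orbit connect0.
have nN t : t \in orbit (step f) y -> f t != None.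
  move=> tO; apply/eqP => ft.
  have st : step f t = t by rewrite /step ft.
  have ty : fconnect (step f) t y by rewrite (fconnect_cycle cyc tO).
  by move: ft; rewrite -(fconnect_fix st ty) fy.
have se t : f t != None -> f t = Some (step f t) by rewrite /step; case: (f t).
have ce : ucycleb e (orbit (step f) y).
  rewrite /ucycleb orbit_uniq andbT.
  apply: (@sub_in_cycle _ [pred t | f t != None] (frel (step f))) cyc.
    move=> t t' /= tN _ /eqP <-; by have [] := vf _ _ (se _ tN).
  by apply/allP => t /nN.
move: cyc ce (@ea (orbit (step f) y)).
rewrite /orbit; have : (0 < order (step f) y)%N by apply: order_gt0.
(* Orbits of size 1 and 2 are a loop and an edge used from both ends; a longer one is a cycle of
   [e]. *)
case: (order (step f) y) => [//|[|[|n]]] _; rewrite /= ?size_traject.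
- by rewrite sy andbT => /eqP zy; have [+ _] := vf _ _ fy; rewrite zy ei.
- rewrite eqxx andbT sy => /eqP sz _ _.
  have [_] := vf _ _ fy; rewrite se ?sz ?eqxx //.
  by apply: nN; rewrite -sy -fconnect_orbit fconnect1.
- by move=> _ -> /(_ isT).
Qed.

Lemma tree_rooted r : is_tree e -> exists2 par, rooted par r & e = par_rel par.
Proof.
move=> [[es _] _ ec _].
have [||f [fr fe f2]] := @forest_parent _ _ es ei ea [set r].
- by move=> v; exists r; rewrite ?inE.
- by move=> _ _ /set1P-> /set1P->.
have vf : valid_parents e f.
  by apply/valid_parentsP => v y fv; rewrite fe fv eqxx; split=> //; apply: f2.
have fN v : f v = None -> v = r.
  by move/eqP; rewrite fr => /set1P.
exists (step f).
  split=> [|v]; last by have [r' /fN->] := reach_root v vf.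
  by rewrite /step; have /eqP-> : f r == None by rewrite fr inE.
apply: funext => v; apply: funext => w; rewrite /par_rel.
have [->|vw] := eqVneq v w; first by rewrite ei.
rewrite fe /step; congr (_ || _).
  by case: (f v) => //=; rewrite (negbTE vw).
by case: (f w) => //=; rewrite (eq_sym w) (negbTE vw).
Qed.

End Reach.

(** * Degrees and walks in rooted trees *)

Section Degrees.
Variable V : finType.
Implicit Types (par : V -> V) (r u v w a b : V).

(** No neighbour is both a child and the parent, so the two kinds add up. *)
Lemma degree_par par r v : rooted par r ->
  degree (par_rel par) v =
  (\sum_(y : V) ((par y == v) && (y != v)) + (par v != v))%N.
Proof.
move=> rt; rewrite /degree -sum1dep_card big_mkcond /=.
transitivity (\sum_(y : V) ((par y == v) && (y != v) + (y == par v) * (y != v)))%N.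
  apply: eq_bigr => y _; rewrite /par_rel eq_sym.
  have [->|yv] := eqVneq y v; first by rewrite /= andbF muln0.
  rewrite /= andbT muln1 [_ == y]eq_sym.
  have [yp|_] := eqVneq y (par v); last by case: (par y == v).
  suff /negbTE-> : par y != v by [].
  rewrite yp (par2_neq rt) //; apply: contraNneq yv => vr.
  by rewrite yp vr (proj1 rt).
rewrite big_split; congr (_ + _)%N.
rewrite (bigD1 (par v)) //= eqxx mul1n big1 ?addn0 //.
by move=> y /negbTE->.
Qed.

(** Only the old and the new parent of [b] change degree. The additive form avoids truncated
    subtraction. *)
Lemma degree_reparent par r r' b u v :
  rooted par r -> rooted (reparent par b u) r' ->
  par b != b -> u != b ->
  (degree (par_rel (reparent par b u)) v + (par b == v) =
   degree (par_rel par) v + (u == v))%N.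
Proof.
move=> rt rt' pb ub; rewrite (degree_par _ rt) (degree_par _ rt').
rewrite (bigD1 b) //= [in RHS](bigD1 b) //= /reparent eqxx.
have -> : (\sum_(i | i != b) (((if i == b then u else par i) == v) && (i != v)) =
          \sum_(i | i != b) ((par i == v) && (i != v)))%N.
  by apply: eq_bigr => i /negbTE->.
have [vb|bv] := eqVneq v b.
  by rewrite vb ub (negbTE ub) pb (negbTE pb).
by rewrite !andbT; lia.
Qed.

Lemma degree_child par r v : rooted par r -> (1 < degree (par_rel par) v)%N ->
  exists2 b, par b = v & b != v.
Proof.
move=> rt; rewrite (degree_par _ rt) => H.
have [b /andP[/eqP pb bv]|N] := pickP (fun b => (par b == v) && (b != v)).
  by exists b.
by move: H; rewrite big1 ?add0n => [|y _]; [case: (_ != _)|rewrite N].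
Qed.

(** Hanging a branch on the root itself only shortens chains of parents, so no cycle arises. *)
Lemma rooted_move par u b : rooted par u -> rooted (reparent par b u) u.
Proof.
move=> [pu ru]; split; first by rewrite /reparent; case: eqP.
apply: (fconnect_ind ru) => // v vu IH.
have := fconnect1 (reparent par b u) v; rewrite {2}/reparent; case: eqP => // _ H.
exact: connect_trans H IH.
Qed.

Lemma degree_sequence_bij (W : finType) (e : rel V) (e' : rel W) (f : V -> W) :
  bijective f -> (forall v, degree e' (f v) = degree e v) ->
  degree_sequence e' = degree_sequence e.
Proof.
move=> [g fK gK] H; apply/perm_sortP.
- by move=> m n; apply: leq_total.
- by move=> m n p mn np; apply: leq_trans np mn.
- by move=> m n; rewrite andbC => /anti_leq.
have -> : [seq degree e x | x <- enum V] = [seq degree e' y | y <- [seq f x | x <-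
  enum V]].
  by rewrite -map_comp; apply: eq_map => v; rewrite /= H.
apply: perm_map; apply: uniq_perm; rewrite ?enum_uniq //.
  by rewrite map_inj_uniq ?enum_uniq //; apply: can_inj fK.
by move=> y; rewrite mem_enum inE -[y]gK map_f ?mem_enum.
Qed.

Lemma fconnect_child par v w : fconnect par v w -> v != w ->
  exists c, [/\ fconnect par v c, par c = w & c != w].
Proof.
move/iter_findex; move: (findex par v w) => n; elim: n v => [|n IH] v.
  by move=> /= ->; rewrite eqxx.
rewrite iterSr => E vw; have [pv|pv] := eqVneq (par v) w; first by exists v.
have [c [vc pc cw]] := IH _ E pv.
by exists c; split=> //; apply: connect_trans (fconnect1 _ _) vc.
Qed.

Lemma avoid_par par r v w a : rooted par r -> fconnect par v w ->
  ~~ (fconnect par v a && fconnect par a w) ->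
  connect (avoid (par_rel par) a) v w.
Proof.
move=> rt vw; have [n] : exists n, iter n par v = w.
  by exists (findex par v w); apply: iter_findex.
elim: n v vw => [|n IH] v vw; first by move=> /= ->; rewrite connect0.
rewrite iterSr => E nva.
have pvw : fconnect par (par v) w by rewrite -E fconnect_iter.
have va : v != a by apply: contraNneq nva => <-; rewrite connect0.
have [pv|pv] := eqVneq (par v) v; first by move: E; rewrite pv => E; apply: IH.
have npa : ~~ (fconnect par (par v) a && fconnect par a w).
  by rewrite -fconnect_step.
apply: connect_trans (IH _ pvw E npa); apply: connect1.
rewrite avoidE va /par_rel eq_sym pv eqxx /=.
by apply: contraNneq npa => pva; rewrite pva connect0 -pva.
Qed.

End Degrees.

(** * Minimal trees *)

Section Minimal.
Variables (R : realFieldType) (x : R) (x_gt0 : 0 < x) (V : finType) (e : rel V).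
Implicit Types (par : V -> V) (r u v w a b : V).
Hypothesis e_tree : is_tree e.
Hypothesis e_min : forall e' : rel V, is_tree e' ->
  degree_sequence e' = degree_sequence e ->
  wforests x e set0 <= wforests x e' set0.

Local Notation z v := (wforests x e [set v]).

Let es : symmetric e. Proof. by case: e_tree => -[]. Qed.
Let ei : irreflexive e. Proof. by case: e_tree => -[]. Qed.
Let ea : acyclic e. Proof. by case: e_tree. Qed.
Let ec u v : connect e u v. Proof. by case: e_tree. Qed.
Let root_at := fun r => tree_rooted ei ea r e_tree.

(** Branches at children of [w] go to [u] one at a time: [wforests_move] preserves the comparison of
    [u] with [w], and the bound on [k] leaves [w] a child for each move. *)
Lemma move_branches par u w k : rooted par u -> u != w ->
  (k < degree (par_rel par) w)%N ->
  wforests x (par_rel par) [set u] <= wforests x (par_rel par) [set w] ->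
  exists par', [/\ rooted par' u,
    forall v, (degree (par_rel par') v + k * (w == v) =
               degree (par_rel par) v + k * (u == v))%N,
    wforests x (par_rel par') [set u] <= wforests x (par_rel par') [set w],
    wforests x (par_rel par') set0 <= wforests x (par_rel par) set0 &
    (0 < k)%N ->
      wforests x (par_rel par') set0 < wforests x (par_rel par) set0].
Proof.
move=> rt uw kd le; elim: k kd => [|k IH] kd; first by exists par.
have [p1 [rt1 d1 le1 wle wlt]] := IH (ltnW kd).
have [b pb bw] : exists2 b, p1 b = w & b != w.
  by apply: (degree_child rt1); have := d1 w; rewrite (negbTE uw) eqxx; lia.
have bu : b != u by apply: contraNneq uw => bu; rewrite -pb bu (proj1 rt1).
have rt2 := rooted_move b rt1.
pose C := [set v | fconnect p1 v b]; pose p0 := reparent p1 b b.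
have bC : b \in C by rewrite inE.
have uC : u \notin C.
  by rewrite inE; apply: contra bu => /(fconnect_fix (proj1 rt1))->.
have wC : w \notin C.
  rewrite inE; apply: contra bw => wb; rewrite (fconnect_anti rt1 _ wb) //.
  by rewrite -pb fconnect1.
have [B B0 pen] : exists2 B, 0 < B & pendant x p0 C b B.
  apply: pendant_closed => // v; rewrite /p0 /reparent !inE.
  by case: (eqVneq v b) => [->|vb _]; rewrite ?eqxx // fconnect_step.
have p0b : p0 b = b by rewrite /p0 /reparent eqxx.
have pub : p0 u != b by rewrite /p0 /reparent [u == b]eq_sym (negbTE bu) (proj1
  rt1) eq_sym.
have pwb : p0 w != b.
  by rewrite /p0 /reparent [w == b]eq_sym (negbTE bw) -pb (par2_neq rt1).
have := wforests_move x_gt0 B0 bC uC wC uw p0b pub pwb pen.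
rewrite /= /p0 !reparentK -pb reparent_id pb => /(_ le1)[lt2 le2].
exists (reparent p1 b u); split=> //.
- move=> v; have := degree_reparent v rt1 rt2.
  rewrite pb [w == b]eq_sym [u == b]eq_sym bw bu => /(_ isT isT) d2.
  by rewrite !mulSn addnA d2 addnAC d1 addnAC -addnA.
- by apply: ltW; apply: lt_le_trans lt2 wle.
- by move=> _; apply: lt_le_trans lt2 wle.
Qed.

Lemma degree_gt0 u w : u != w -> (0 < degree e u)%N.
Proof.
move=> uw; apply/card_gt0P; case/connectP: (ec u w) => -[|y p] /=.
  by move=> _ E; rewrite E eqxx in uw.
by case/andP=> uy _ _; exists y; rewrite inE.
Qed.

(** Otherwise the surplus branches of [w] could be moved to [u], giving a tree with the same degree
    sequence and a smaller count. *)
Lemma minimal_degree u w : z u <= z w -> (degree e w <= degree e u)%N.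
Proof.
move=> le; rewrite leqNgt; apply/negP => lt.
have uw : u != w by apply: contraTneq lt => ->; rewrite ltnn.
have [par rt E] := root_at u.
(* Moving this many branches interchanges the two degrees, so the transposition of [u] and [w]
   matches the degree sequences. *)
pose k := (degree e w - degree e u)%N.
have kd : (k < degree (par_rel par) w)%N.
  by rewrite -E /k; have := degree_gt0 uw; lia.
have [|p' [rt' d' _ _]] := move_branches rt uw kd; first by rewrite -E.
rewrite subn_gt0 => /(_ lt); rewrite -E ltNge => /negP; apply.
apply: e_min; first exact: par_rel_tree rt'.
apply: (@degree_sequence_bij _ _ _ _ (tperm u w)).
  by exists (tperm u w) => v; rewrite tpermK.
move=> v; move: (d' (tperm u w v)); rewrite -E /k;
  case: tpermP => [->|->|/eqP vu /eqP vw].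
- by rewrite eqxx (negbTE uw); lia.
- by rewrite eqxx eq_sym (negbTE uw); lia.
by rewrite ![_ == v]eq_sym (negbTE vu) (negbTE vw); lia.
Qed.

(** If a conclusion failed, [wforests_swap] would lower the count with all degrees kept. The
    [connect] hypotheses place [w] outside the branch at [a] seen from [u], and [u] outside the
    branch at [b] seen from [w]. *)
Lemma minimal_swap u w a b : u != w -> e u a -> e w b ->
  connect (avoid e a) u w -> connect (avoid e b) w u -> z u <= z w ->
  z a <= z b /\ (z u < z w -> z a < z b).
Proof.
move=> uw ua wb cuw cwu le.
suff K : ~ (z b < z a \/ z u < z w /\ z b <= z a).
  split; first by rewrite leNgt; apply/negP => ?; apply: K; left.
  by move=> lt; rewrite ltNge; apply/negP => ?; apply: K; right.
move=> H; have [par rt E] := root_at u; have [pu ru] := rt.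
have au : a != u by apply: contraTneq ua => ->; rewrite ei.
have bw : b != w by apply: contraTneq wb => ->; rewrite ei.
have pa : par a = u.
  by move: ua; rewrite E /par_rel pu => /andP[ua /orP[/eqP E'|/eqP//]];
    rewrite E' eqxx in ua.
pose Ca := [set v | fconnect par v a]; pose Cb := [set v | fconnect par v b].
have nu v : v != u -> ~~ fconnect par u v.
  by move=> vu; apply: contra vu => /(fconnect_fix pu)->.
have closedC c d : par c = d -> closed (avoid e d) [set v | fconnect par v c].
  move=> pcd v y; rewrite avoidE E /par_rel !inE.
  move=> /and3P[/andP[vy /orP[/eqP pvy|/eqP pyv]] vd yd].
    have vc : v != c by apply: contraNneq yd => vc; rewrite -pvy vc pcd.
    by rewrite fconnect_step // pvy.
  have yc : y != c by apply: contraNneq vd => yc; rewrite -pyv yc pcd.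
  by rewrite [RHS]fconnect_step // pyv.
have wCa : w \notin Ca.
  have cl : closed (avoid e a) Ca.
    move=> v y; rewrite avoidE E /par_rel !inE.
    by move=> /and3P[/andP[vy /orP[/eqP<-|/eqP<-]] va ya]; rewrite -fconnect_step.
  by rewrite -(closed_connect cl cuw) inE nu.
(* Were [b] the parent of [w], a walk from [w] avoiding [b] would stay among the descendants of [w]
   and miss the root [u]. *)
have pb : par b = w.
  move: (wb); rewrite E /par_rel => /andP[_ /orP[/eqP pwb|/eqP//]].
  have := closed_connect (closedC _ _ pwb) cwu.
  by rewrite !inE connect0 (negbTE (nu _ _)) // eq_sym.
have bu : b != u by apply: contraNneq uw => bu; rewrite -pb bu pu.
have ab : a != b by apply: contraNneq uw => ab; rewrite -pa ab pb.
have aCa : a \in Ca by rewrite inE.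
have bCb : b \in Cb by rewrite inE.
have uCa : u \notin Ca by rewrite inE nu.
have uCb : u \notin Cb by rewrite inE nu.
have bCa : b \notin Ca by move: wCa;
  rewrite !inE [fconnect _ b _]fconnect_step 1?eq_sym // pb.
have aCb : a \notin Cb by move: uCb;
  rewrite !inE [fconnect _ a _]fconnect_step // pa.
have wCb : w \notin Cb.
  rewrite inE; apply: contra bw => wb'; rewrite (fconnect_anti rt _ wb') //.
  by rewrite -pb fconnect1.
pose p0 := reparent (reparent par a a) b b.
have p0E v : v != a -> v != b -> p0 v = par v by move=> /negbTE va /negbTE vb;
  rewrite /p0 /reparent vb va.
have p0a : p0 a = a by rewrite /p0 /reparent (negbTE ab) eqxx.
have p0b : p0 b = b by rewrite /p0 /reparent eqxx.
have pen c : c \in [set a; b] ->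
    exists2 A, 0 < A & pendant x p0 [set v | fconnect par v c] c A.
  move=> cab; apply: pendant_closed => //; first by rewrite inE.
  move=> v; case: (eqVneq v a) => [->|va]; first by rewrite p0a eqxx.
  case: (eqVneq v b) => [->|vb]; first by rewrite p0b eqxx.
  rewrite p0E // !inE => _; rewrite fconnect_step //.
  by apply: contraTneq cab => <-; rewrite !inE negb_or va.
have [A A0 penA] := pen a (set21 _ _); have [B B0 penB] := pen b (set22 _ _).
have [ua' wa] : u != a /\ w != a.
  by split; [rewrite eq_sym|apply: contraNneq wCa => ->].
have [ub wb'] : u != b /\ w != b by rewrite ![_ == b]eq_sym.
have nb : par w != b by rewrite -pb (par2_neq rt).
have na : par w != a.
  by apply: contraNneq wCa => pwa; rewrite inE fconnect_step // pwa connect0.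
have := @wforests_swap _ _ x_gt0 _ p0 u w a b Ca Cb A B A0 B0 aCa bCa uCa wCa bCb
  aCb uCb wCb uw p0a p0b.
rewrite !p0E // pu na nb ua' ub => /(_ isT isT isT isT penA penB).
have p0K p q : reparent (reparent p0 a p) b q = reparent (reparent par a p) b q.
  by rewrite (reparentC p0 p q ab) /p0 reparentK -(reparentC (reparent par a a) p
    q ab) reparentK.
have -> : reparent (reparent p0 a u) b w = par by rewrite p0K -pb -{1}pa
  !reparent_id.
have -> : reparent (reparent p0 a w) b u = reparent (reparent par b u) a w by
  rewrite p0K reparentC.
rewrite /= -E; set T' := reparent _ a w => /(_ le H); rewrite ltNge => /negP; apply.
have rt1 := rooted_move b rt.
have T'E v : v != a -> v != b -> T' v = par v.
  by move=> /negbTE va /negbTE vb; rewrite /T' /reparent va vb.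
(* Off both branches the chains of parents are unchanged. In particular [w] still reaches [u], and
   then so do [a], now below [w], and [b], now below [u]. *)
have T'u v : ~~ fconnect par v a -> ~~ fconnect par v b -> fconnect T' v u.
  move: v; apply: (fconnect_ind ru) => // v vu IH va vb.
  have va' : v != a by apply: contraNneq va => ->.
  have vb' : v != b by apply: contraNneq vb => ->.
  apply: connect_trans (fconnect1 _ _) _; rewrite T'E //.
  by apply: IH; rewrite -fconnect_step.
have rt' : rooted T' u.
  split; first by rewrite T'E.
  apply: (fconnect_ind ru) => // v vu IH; apply: connect_trans (fconnect1 _ _) _.
  have [->|va] := eqVneq v a.
    by rewrite {2}/T' /reparent eqxx; apply: T'u; [move: wCa|move: wCb];
      rewrite inE.
  have [->|vb] := eqVneq v b; last by rewrite T'E.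
  by rewrite {2}/T' /reparent eq_sym (negbTE ab) eqxx.
apply: e_min; first exact: par_rel_tree rt'.
apply: (@degree_sequence_bij _ _ _ _ id); first by exists id.
move=> v; have := degree_reparent v rt1 rt'; have := degree_reparent v rt rt1.
rewrite pb [w == b]eq_sym bw ub => /(_ isT isT) d1.
have -> : reparent par b u a = u by rewrite /reparent (negbTE ab) pa.
rewrite ua' wa => /(_ isT isT) d2.
by apply/eqP; rewrite /= E -(eqn_add2r (u == v)) -/T' d2 d1.
Qed.

(* If [z v < z w], both ends of the path from [v] up to [w] can be extended, by a
   child [a] of [v] and the parent of [w], and then [z a < z (par w)]. *)
Lemma minimal_ancestor par r : rooted par r -> e = par_rel par ->
  (forall v, z r <= z v) -> forall w v, fconnect par v w -> z w <= z v.
Proof.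
move=> rt E rmin; apply: (fconnect_ind (proj2 rt)) => // w wr IH v vw.
have [->//|vnw] := eqVneq v w.
rewrite leNgt; apply/negP => lt.
have [pr rr] := rt.
have [c [_ pc cw]] := fconnect_child vw vnw.
(* [w] has the child [c] and a parent; by [minimal_degree] the degree of [v] is no smaller, so [v]
   has a child too. *)
have dw : (1 < degree e w)%N.
  rewrite E (degree_par _ rt) (par_neq rt wr) addn1 ltnS.
  by rewrite (bigD1 c) //= pc eqxx cw.
have [a pa av] : exists2 a, par a = v & a != v.
  by apply: (degree_child rt); rewrite -E;
    apply: leq_trans dw (minimal_degree (ltW lt)).
have va : e v a by rewrite E par_rel_sym -pa (par_rel_par rt) //;
  apply: contraNneq av => ar; rewrite -pa ar pr.
have aw' : fconnect par a (par w).
  apply: connect_trans (fconnect1 _ _) _; rewrite pa.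
  exact: connect_trans vw (fconnect1 _ _).
have ww : e w (par w) by rewrite E (par_rel_par rt).
have cvw : connect (avoid e a) v w.
  rewrite E; apply: (avoid_par rt) => //; apply: contra av => /andP[va' _].
  by rewrite (fconnect_anti rt va') // -pa fconnect1.
have cwv : connect (avoid e (par w)) w v.
  rewrite (sym_connect_sym (avoid_sym es _)) E.
  apply: (avoid_par rt) => //; apply: contra (par_neq rt wr) => /andP[_ H].
  by rewrite (fconnect_anti rt H) // fconnect1.
have [_ /(_ lt)] := minimal_swap vnw va ww cvw cwv (ltW lt).
by rewrite ltNge IH.
Qed.

End Minimal.

(** * Breadth-first order *)

Section BreadthFirst.
Variables (R : realFieldType) (V : finType) (par : V -> V) (r : V) (z : V -> R).
Hypothesis rt : rooted par r.

Definition le_z : rel V := fun a b => z a <= z b.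

Definition children v : seq V :=
  sort le_z [seq y <- enum V | (par y == v) && (y != v)].

(** The list of labelled vertices once its first [i] entries have been processed; its size is the
    counterpart of [greedy_labelled]. *)
Fixpoint bfs i : seq V :=
  if i is j.+1 then
    bfs j ++ (if (j < size (bfs j))%N then children (nth r (bfs j) j) else [::])
  else [:: r].

Lemma mem_children v y : (y \in children v) = (par y == v) && (y != v).
Proof. by rewrite mem_sort mem_filter mem_enum andbT. Qed.

Lemma children_uniq v : uniq (children v).
Proof. by rewrite sort_uniq filter_uniq ?enum_uniq. Qed.

Lemma size_children v : degree (par_rel par) v = (size (children v) + (par v !=
  v))%N.
Proof.
rewrite (degree_par _ rt) size_sort size_filter -sum1_count [in RHS]big_mkcond
  big_enum.
by congr (_ + _)%N; apply: eq_bigr => y _; case: ifP.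
Qed.

Lemma nth_notin_take (T : eqType) (x0 : T) s i :
  uniq s -> (i < size s)%N -> nth x0 s i \notin take i s.
Proof.
move=> us si; have := take_uniq i.+1 us.
by rewrite (take_nth x0) // rcons_uniq => /andP[].
Qed.

(** Both halves are proved together: an appended child is new because otherwise its parent would be
    among the entries already processed. *)
Lemma bfs_inv i : uniq (bfs i) /\
  forall x, (x \in bfs i) = (x == r) || (par x \in take i (bfs i)).
Proof.
elim: i => [|i [u m]]; first by split=> // x; rewrite take0 orbF inE.
rewrite [bfs i.+1]/=; case: ltnP => [si|si]; last first.
  by rewrite cats0; split=> // x; rewrite m !take_oversize // ltnW.
set v := nth r (bfs i) i; have vn := nth_notin_take r u si.
have pr : par r = r by case: rt.
split.
  rewrite cat_uniq u children_uniq andbT /=; apply/hasPn => x.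
  rewrite mem_children => /andP[/eqP px xv]; rewrite /= m negb_or px vn andbT.
  by apply: contraNneq xv => xr; rewrite -px xr pr.
move=> x; rewrite takel_cat // (take_nth r) // mem_cat m mem_rcons inE -/v
  mem_children.
have [//|xr] := eqVneq x r; have [px|_] := eqVneq (par x) v; last by rewrite orbF.
have -> : x != v by rewrite -px eq_sym (par_neq rt).
by rewrite orbT.
Qed.

Let n := #|V|.
Let s := bfs n.
Let L i := size (bfs i).

(** A list whose entries have all been processed is closed under children. So the queue cannot run
    empty early, and [n] rounds list everything. *)
Lemma bfs_full i : (size (bfs i) <= i)%N -> forall x, x \in bfs i.
Proof.
move=> si; apply: (fconnect_ind (proj2 rt)) => [|v vr IH].
  by rewrite (proj2 (bfs_inv i)) eqxx.
by rewrite (proj2 (bfs_inv i)) take_oversize // IH orbT.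
Qed.

Lemma size_bfs_le i : (L i <= n)%N.
Proof. by rewrite /L -(card_uniqP (proj1 (bfs_inv i))) max_card. Qed.

Lemma bfs_mem x : x \in s.
Proof. by apply: bfs_full; apply: size_bfs_le. Qed.

Lemma bfs_uniq : uniq s. Proof. exact: (proj1 (bfs_inv n)). Qed.

Lemma size_bfs : size s = n.
Proof.
rewrite -(card_uniqP bfs_uniq); apply: eq_card => x; exact: bfs_mem.
Qed.

Lemma size_bfs_gt i : (i < n)%N -> (i < L i)%N.
Proof.
move=> ni; rewrite ltnNge; apply/negP => le; have m := bfs_full le.
have : (#|V| <= size (bfs i))%N.
  by rewrite -(card_uniqP (proj1 (bfs_inv i)));
    apply/subset_leq_card/subsetP => x _; apply: m.
by rewrite leqNgt (leq_ltn_trans le ni).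
Qed.

Lemma bfs_prefix i j : (i <= j)%N -> exists t, bfs j = bfs i ++ t.
Proof.
elim: j => [|j IH]; first by case: i => // _; exists [::]; rewrite cats0.
rewrite leq_eqVlt => /predU1P[->|]; first by exists [::]; rewrite cats0.
by rewrite ltnS => /IH[t E] /=; rewrite {1}E -catA; eexists.
Qed.

Local Notation v i := (nth r s i).

Lemma nth_bfs i j : (i <= n)%N -> (j < L i)%N -> nth r (bfs i) j = v j.
Proof. by move=> /bfs_prefix[t E] ji; rewrite /s E nth_cat ji. Qed.

Lemma bfsS i : (i < n)%N -> bfs i.+1 = bfs i ++ children (v i).
Proof. by move=> ni /=; rewrite size_bfs_gt // nth_bfs ?size_bfs_gt // ltnW. Qed.

Lemma sizeS_bfs i : (i < n)%N -> L i.+1 = (L i + size (children (v i)))%N.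
Proof. by move=> ni; rewrite /L bfsS // size_cat. Qed.

Lemma leq_size_bfs i j : (i <= j)%N -> (L i <= L j)%N.
Proof. by move=> /bfs_prefix[t E]; rewrite /L E size_cat leq_addr. Qed.

Lemma nth_children i k : (i < n)%N -> (k < size (children (v i)))%N ->
  v (L i + k) = nth r (children (v i)) k.
Proof.
move=> ni ki; rewrite -(@nth_bfs i.+1) // ?sizeS_bfs ?ltn_add2l //.
by rewrite bfsS // nth_cat ltnNge leq_addr /= addKn.
Qed.

(** Round [i] appends the children of [v i] as one block, and later rounds never move it; this
    interval is the one tested by [greedy_child]. *)
Lemma bfs_childP i j : (i < n)%N -> (j < n)%N ->
  (L i <= j < L i.+1)%N = (par (v j) == v i) && (v j != v i).
Proof.
move=> ni nj; rewrite -mem_children sizeS_bfs //; apply/idP/idP => [/andP[ij ji]|H].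
  have ki : (j - L i < size (children (v i)))%N by rewrite ltn_subLR.
  by rewrite -{1}(subnKC ij) nth_children ?mem_nth.
pose k := index (v j) (children (v i)).
have kS : (k < size (children (v i)))%N by rewrite index_mem.
have E : v (L i + k) = v j by rewrite nth_children // nth_index.
have /eqP <- : (L i + k == j)%N.
  rewrite -(nth_uniq r _ _ bfs_uniq) ?E ?size_bfs //.
  by apply: leq_trans (size_bfs_le i.+1); rewrite sizeS_bfs // ltn_add2l.
by rewrite leq_addr ltn_add2l.
Qed.

Lemma bfs_index x : (index x s < n)%N.
Proof. by rewrite -size_bfs index_mem bfs_mem. Qed.

Lemma nth_bfs_index x : v (index x s) = x.
Proof. by rewrite nth_index // bfs_mem. Qed.

Lemma card_vertices_gt0 : (0 < n)%N. Proof. by apply/card_gt0P; exists r. Qed.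

Lemma bfs_root : v 0 = r.
Proof. by rewrite -(@nth_bfs 0). Qed.

Lemma bfs_parent j : (0 < j < n)%N ->
  let i := index (par (v j)) s in
  [/\ (i < j)%N, (L i <= j)%N, (j < L i.+1)%N & v j != r].
Proof.
move=> /andP[j0 jn] i; have vr : v j != r.
  by rewrite -[X in _ != X]bfs_root nth_uniq ?size_bfs ?bfs_uniq
    ?card_vertices_gt0 // -lt0n.
have : (L i <= j < L i.+1)%N.
  by rewrite bfs_childP ?bfs_index // /i nth_bfs_index eqxx eq_sym (par_neq rt).
case/andP=> ij ji; split=> //.
by apply: leq_trans ij; apply: size_bfs_gt; apply: bfs_index.
Qed.

Lemma bfs_ancestor x y : fconnect par x y -> (index y s <= index x s)%N.
Proof.
move/iter_findex <-; elim: (findex par x y) => //= k; apply: leq_trans.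
set t := iter k par x; have [it|it] := posnP (index t s).
  have -> : t = r by rewrite -(nth_bfs_index t) it bfs_root.
  by rewrite (proj1 rt).
have [] := @bfs_parent (index t s); first by rewrite it bfs_index.
by rewrite nth_bfs_index => /ltnW.
Qed.

Hypothesis z_anc : forall a b, fconnect par b a -> z a <= z b.
Hypothesis z_child : forall u w a b, u != w -> par a = u -> a != u -> par b = w ->
  b != w -> ~~ fconnect par w a -> ~~ fconnect par u b -> z u <= z w -> z a <= z b.

(** Strong induction on [q]. The parents of [v p] and [v q] occur in this order or coincide:
    siblings are sorted by [z], and distinct parents are compared by induction, after which
    [z_child] passes to the children. *)
Lemma bfs_sorted p q : (p < q < n)%N -> z (v p) <= z (v q).
Proof.
elim/ltn_ind: q p => q IH p /andP[pq qn].
have q0 : (0 < q)%N by apply: leq_ltn_trans pq.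
have [|jq Ljq qLj bnr] := @bfs_parent q; first by rewrite q0.
have [->|p0] := posnP p; first by rewrite bfs_root z_anc // (proj2 rt).
have [|ip Lip pLi anr] := @bfs_parent p; first by rewrite p0 (ltn_trans pq).
move: (bfs_index (par (v p))) (bfs_index (par (v q)))
      (nth_bfs_index (par (v p))) (nth_bfs_index (par (v q))).
move: (index (par (v p)) s) (index (par (v q)) s) ip Lip pLi jq Ljq qLj.
move=> i j ip Lip pLi jq Ljq qLj ni nj vi vj.
have : (i <= j)%N.
  rewrite leqNgt; apply/negP => /leq_size_bfs ji.
  by have := leq_trans qLj (leq_trans ji Lip); rewrite ltnNge (ltnW pq).
rewrite leq_eqVlt => /predU1P[ij|ij].
  rewrite -ij in qLj Ljq; rewrite !sizeS_bfs // in pLi qLj.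
  have kp : (p - L i < size (children (v i)))%N by rewrite ltn_subLR.
  have kq : (q - L i < size (children (v i)))%N by rewrite ltn_subLR.
  rewrite -(subnKC Lip) -(subnKC Ljq) !nth_children //.
  apply: (@sorted_leq_nth _ le_z); rewrite ?inE ?leq_sub2r ?(ltnW pq) //.
  - by move=> ? ? ?; apply: le_trans.
  - by move=> ?; apply: lexx.
  - by apply: sort_sorted => ? ?; apply: le_total.
(* The case of [v p] being an ancestor of [v q] is outside the reach of [z_child] and falls to
   [z_anc]. *)
have [/(connect_trans (fconnect1 _ _))/z_anc//|wa] :=
  boolP (fconnect par (par (v q)) (v p)).
apply: (z_child _ erefl _ erefl _ wa).
- by rewrite -vi -vj nth_uniq ?size_bfs ?bfs_uniq // ltn_eqF.
- by rewrite eq_sym (par_neq rt).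
- by rewrite eq_sym (par_neq rt).
- apply/negP => /bfs_ancestor; rewrite -vi !index_uniq ?size_bfs ?bfs_uniq //.
  by rewrite leqNgt (ltn_trans ij jq).
- by rewrite -vi -vj IH // ij nj.
Qed.

Hypothesis z_degree : forall u w, z u <= z w ->
  (degree (par_rel par) w <= degree (par_rel par) u)%N.

Local Notation D := (degree_sequence (par_rel par)).

(** Along [s] the weights [z] do not decrease, so by [z_degree] the degrees do not increase and
    sorting changes nothing. *)
Lemma degree_sequence_bfs : D = [seq degree (par_rel par) x | x <- s].
Proof.
apply: (@sorted_eq _ geq).
- by move=> a b c ba cb; apply: leq_trans cb ba.
- by move=> a b; rewrite andbC => /anti_leq.
- by apply: sort_sorted => a b; apply: leq_total.
- apply/(sortedP 0%N) => i; rewrite size_map => si.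
  rewrite !(nth_map r) // 1?ltnW //; apply: z_degree; apply: bfs_sorted.
  by rewrite leqnn -size_bfs.
rewrite perm_sort; apply: perm_map; apply: uniq_perm;
  rewrite ?enum_uniq ?bfs_uniq //.
by move=> x; rewrite mem_enum bfs_mem.
Qed.

Lemma greedy_new_bfs i : (i < n)%N -> greedy_new D i = size (children (v i)).
Proof.
move=> ni; rewrite /greedy_new degree_sequence_bfs !(nth_map r) ?size_bfs
  ?card_vertices_gt0 //.
rewrite !size_children; case: posnP => [->|i0].
  by rewrite bfs_root (proj1 rt) eqxx addn0.
have [|_ _ _ vr] := @bfs_parent i; first by rewrite i0.
by rewrite (par_neq rt) ?addn1.
Qed.

Lemma greedy_labelled_bfs i : (i <= n)%N -> greedy_labelled D i = L i.
Proof.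
elim: i => [//|i IH] ni; rewrite sizeS_bfs //= IH ?greedy_new_bfs //; exact: ltnW.
Qed.

Lemma greedy_child_bfs x y :
  greedy_child D (index x s) (index y s) = (par y == x) && (y != x).
Proof.
rewrite /greedy_child greedy_labelled_bfs ?greedy_new_bfs ?bfs_index //; last first.
  by rewrite ltnW // bfs_index.
by rewrite -sizeS_bfs ?bfs_index // bfs_childP ?bfs_index // !nth_bfs_index.
Qed.

Lemma bfs_greedy_iso : graph_iso (par_rel par) (greedy_tree D).
Proof.
have sD : size D = n by rewrite degree_sequence_bfs size_map size_bfs.
have ix x : (index x s < size D)%N by rewrite sD bfs_index.
exists (fun x => Ordinal (ix x)); split.
  exists (fun i : 'I_(size D) => v i) => [x|i]; first by rewrite /= nth_bfs_index.
  by apply: val_inj; rewrite /= index_uniq ?bfs_uniq // size_bfs -sD.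
move=> x y; rewrite /greedy_tree /= !greedy_child_bfs /par_rel (eq_sym x y).
by case: (y == x); rewrite ?andbF ?andbT //= orbC.
Qed.

End BreadthFirst.

(** * Rooted spanning forests as parent functions *)

Section RootedForests.
Variables (V : finType) (e : rel V).
Hypothesis e_tree : is_tree e.
Implicit Types (f : {ffun V -> option V}) (F : {set {set V}}) (S : {set V}).

Let es : symmetric e. Proof. by case: e_tree => -[]. Qed.
Let ei : irreflexive e. Proof. by case: e_tree => -[]. Qed.
Let ea : acyclic e. Proof. by case: e_tree. Qed.

Lemma set2_eq (x y a b : V) :
  [set x; y] = [set a; b] -> x = a /\ y = b \/ x = b /\ y = a.
Proof.
move=> E; have /set2P yab : y \in [set a; b] by rewrite -E set22.
have /set2P[xa|xb] : x \in [set a; b] by rewrite -E set21.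
  have /set2P[bx|by_] : b \in [set x; y] by rewrite E set22.
    by left; split=> //; case: yab => ->//; rewrite -xa bx.
  by left.
have /set2P[ax|ay] : a \in [set x; y] by rewrite E set21.
  by right; split=> //; case: yab => ->//; rewrite -xb ax.
by right.
Qed.

Lemma adj_of_edges_sym F : symmetric (adj_of_edges F).
Proof. by move=> x y; rewrite /adj_of_edges setUC. Qed.

Lemma adj_of_edges_sub F x y : F \subset edges e -> adj_of_edges F x y -> e x y.
Proof.
move=> /subsetP/(_ _) sF /sF /imsetP[[a b]]; rewrite inE /= => ab.
by case/set2_eq => -[-> ->] //; rewrite es.
Qed.

Lemma acyclic_sub (g : rel V) : subrel g e -> acyclic g.
Proof.
move=> ge c /ea; apply: contra; rewrite /ucycleb => /andP[gc ->]; rewrite andbT.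
by case: c gc => // x p; apply: sub_path.
Qed.

(** Puts a choice of roots into the form required by [forest_parent]. *)
Lemma transversal_componentsP (g : rel V) S : symmetric g ->
  reflect ((forall v, exists2 r, r \in S & connect g v r) /\
           {in S &, forall r r', connect g r r' -> r = r'})
          (is_transversal S (components g) [set: V]).
Proof.
move=> gs; have cs : connect_sym g := sym_connect_sym gs.
have part : partition (components g) [set: V].
  apply: equivalence_partitionP => x y z _ _ _; split; first exact: connect0.
  by move=> /(same_connect cs).
have comp v : [set y in [set: V] | connect g v y] \in components g.
  by apply: imset_f; rewrite inE.
rewrite /is_transversal part subsetT /=; apply: (iffP forall_inP) => [H|[ex un] B].
  have one v : {in S &, forall r r', connect g v r -> connect g v r' -> r = r'}.
    move=> r r' rS r'S vr vr'; have /cards1P[t E] := H _ (comp v).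
    have : r \in [set t] by rewrite -E !inE rS.
    have : r' \in [set t] by rewrite -E !inE r'S.
    by rewrite !inE => /eqP-> /eqP->.
  split=> [v|r r' rS r'S rr']; last by apply: (one r).
  have /cards1P[r E] := H _ (comp v); have := set11 r.
  by rewrite -E !inE => /andP[rS vr]; exists r.
case/imsetP => v _ ->; have [r rS vr] := ex v.
apply/cards1P; exists r; apply/setP => t; rewrite !inE /=.
apply/andP/eqP => [[tS vt]|->//]; apply: un => //.
by rewrite cs -(same_connect cs vr) .
Qed.

Definition fedges f : {set {set V}} :=
  [set [set p.1; p.2] | p : V * V & f p.1 == Some p.2].

Lemma adj_fedges f x y :
  adj_of_edges (fedges f) x y = (f x == Some y) || (f y == Some x).
Proof.
apply/imsetP/orP => [[[a b]]|[fx|fy]].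
- by rewrite inE /= => fa /set2_eq[] [-> ->]; rewrite fa; [left|right].
- by exists (x, y); rewrite ?inE.
- by exists (y, x); rewrite ?inE //= setUC.
Qed.

Definition forest_of f := (fedges f, roots_of f).

(** The condition of [rooted_spanning_forests] with the number of components left free. *)
Definition is_rooted_forest (FR : {set {set V}} * {set V}) : bool :=
  [&& FR.1 \subset edges e, `[< acyclic (adj_of_edges FR.1) >]
    & is_transversal FR.2 (components (adj_of_edges FR.1)) [set: V]].

Lemma fedges_sub f : valid_parents e f -> fedges f \subset edges e.
Proof.
move=> /valid_parentsP vf; apply/subsetP => A /imsetP[[a b]];
  rewrite inE /= => /eqP fa ->.
by apply/imsetP; exists (a, b) => //; rewrite inE; have [] := vf _ _ fa.
Qed.

Lemma connect_step f v r : fconnect (step f) v r -> connect (adj_of_edges (fedges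
  f)) v r.
Proof.
move/iter_findex <-; elim: (findex _ _ _) => //= n IH.
apply: connect_trans IH _; set t := iter n _ v; rewrite /step.
case ft: (f t) => [y|] /=; last exact: connect0.
by apply: connect1; rewrite adj_fedges ft eqxx.
Qed.

(** Adjacent vertices of the forest lead to the same root, one being the parent of the other; so the
    vertices leading to [r'] form a set closed under adjacency. *)
Lemma forest_of_roots f r r' :
  valid_parents e f -> r \in roots_of f -> r' \in roots_of f ->
  connect (adj_of_edges (fedges f)) r r' -> r = r'.
Proof.
move=> vf rS r'S.
have stable t t' : f t = Some t' ->
    forall q, f q = None -> fconnect (step f) t q = fconnect (step f) t' q.
  move=> ft q fq; rewrite fconnect_step ?/step ?ft //.
  by apply/eqP => tq; rewrite tq fq in ft.
move: r'S; rewrite !inE in rS * => /eqP fr'.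
pose C := [pred v | fconnect (step f) v r'].
have cl : closed (adj_of_edges (fedges f)) C.
  move=> t t'; rewrite adj_fedges => /orP[] /eqP ft;
    rewrite /C !inE (stable _ _ ft) //.
move=> /(closed_connect cl); rewrite !inE connect0 => rr'.
by rewrite (fconnect_fix _ rr') // /step (eqP rS).
Qed.

Lemma forest_of_rooted f : valid_parents e f -> is_rooted_forest (forest_of f).
Proof.
move=> vf; have sub := fedges_sub vf; apply/and3P; split=> //=.
  by apply/asboolP; apply: acyclic_sub => x y; apply: adj_of_edges_sub.
apply/transversal_componentsP; first exact: adj_of_edges_sym.
split=> [v|r r' rS r'S]; last exact: forest_of_roots.
have [r fr vr] := reach_root ei ea v vf.
by exists r; [rewrite inE fr|apply: connect_step].
Qed.

(* Where [f] and [g] differ at [v], [g] reverses the whole [f]-path from [v]. *)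
Lemma forest_of_inj : {in valid_parents e &, injective forest_of}.
Proof.
move=> f g /[dup] vf' /valid_parentsP vf /valid_parentsP vg [EF ER];
  apply/ffunP => v.
have E x y : (f x == Some y) || (f y == Some x) = (g x == Some y) || (g y == Some
  x).
  by rewrite -!adj_fedges EF.
have N x : (f x == None) = (g x == None).
  by move/setP/(_ x): ER; rewrite !inE.
have [//|ne] := eqVneq (f v) (g v); exfalso.
have gfv y : f v = Some y -> g y = Some v.
  move=> fv; have := E v y; rewrite fv eqxx /= => /esym/orP[/eqP gv|/eqP//].
  by rewrite fv gv eqxx in ne.
(* Once [g] sends [t1] back to [t0], it can contain the next edge only in reversed direction. *)
have prop t : fconnect (step f) v t -> forall y, f t = Some y -> g y = Some t.
  move/iter_findex <-; elim: (findex _ _ _) => [|n IH] //= y.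
  set t0 := iter n (step f) v in IH *; rewrite {1}/step;
    case ft: (f t0) => [t1|] /=; last first.
    by rewrite ft.
  move=> ft1; have g1 := IH _ ft; have := E t1 y;
    rewrite ft1 eqxx /= => /esym/orP[|/eqP].
    by rewrite g1 => /eqP[ty]; have [_] := vf _ _ ft; rewrite ft1 ty eqxx.
  by rewrite /step ft.
have [r fr vr] := reach_root ei ea v vf'.
have [vEr|vnr] := eqVneq v r.
  have := N v; rewrite vEr fr eqxx => /esym/eqP gr.
  by rewrite vEr fr gr eqxx in ne.
(* The last edge of the path, reversed, gives the root [r] a parent in [g], although [f] and [g]
   have the same roots. *)
have [c [vc cr cn]] := fconnect_child vr vnr.
have fc : f c = Some r.
  by move: cr cn; rewrite /step; case: (f c) => [t|] /= ->; rewrite ?eqxx.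
by have := N r; rewrite fr (prop _ vc _ fc).
Qed.

Lemma forest_of_surj FR : is_rooted_forest FR -> exists2 f,
  valid_parents e f & FR = forest_of f.
Proof.
case: FR => F S /and3P[/= sub /asboolP ac].
have as_ := @adj_of_edges_sym F.
have ae x y : adj_of_edges F x y -> e x y by apply: adj_of_edges_sub.
have ai : irreflexive (adj_of_edges F).
  by move=> x; apply/negP => /ae; rewrite ei.
case/(transversal_componentsP _ as_) => ex un.
have [f [fS fe f2]] := forest_parent as_ ai ac ex un.
exists f; first by apply/valid_parentsP => v y fv; split; [apply: ae;
  rewrite fe fv eqxx|apply: f2].
congr (_, _); apply/setP => A; last by rewrite inE fS.
apply/idP/imsetP => [AF|[[a b]]].
  have /imsetP[[a b]] := subsetP sub _ AF; rewrite inE /= => ab EA.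
  have : adj_of_edges F a b by rewrite /adj_of_edges -EA.
  rewrite fe => /orP[fa|fb]; first by exists (a, b); rewrite ?inE.
  by exists (b, a); rewrite ?inE // EA setUC.
by rewrite inE /= => /eqP fa ->; have : adj_of_edges F a b by rewrite fe fa eqxx.
Qed.

Lemma rf_wforests (R : realType) (x : R) : rf e x = wforests x e set0.
Proof.
have -> : wforests x e set0 = \sum_(FR | is_rooted_forest FR) x ^+ #|FR.2|.
  have -> : \sum_(FR | is_rooted_forest FR) x ^+ #|FR.2| =
      \sum_(FR in forest_of @: [set f | valid_parents e f]) x ^+ #|FR.2|.
    apply: eq_bigl => FR; apply/idP/imsetP => [/forest_of_surj[f vf ->]|[f]].
      by exists f; rewrite ?inE.
    by rewrite inE => vf ->; apply: forest_of_rooted.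
  rewrite big_imset /=; last by move=> f g; rewrite !inE; apply: forest_of_inj.
  by apply: eq_big => [f|f _]; rewrite ?inE ?sub0set ?andbT // setD0.
rewrite /rf; under eq_bigr => k _.
  rewrite /rsf_count -sum1_card natr_sum mulr_suml; under eq_bigr do rewrite mul1r.
  over.
rewrite /= (exchange_big_dep is_rooted_forest) /=; last first.
  by move=> k FR _; rewrite inE => /and4P[? ? _ ?]; apply/and3P.
apply: eq_bigr => FR FRr; have /and3P[sub ac tr] := FRr.
(* A transversal has one element per component, so each forest contributes for a single [k]; it is
   in range because there is at least one root. *)
rewrite (eq_bigl (fun k => k == #|FR.2|)) => [|k]; last first.
  by rewrite inE /= sub ac tr (card_transversal tr) andbT eq_sym.
rewrite big_nat1_eq ltnS max_card andbT ifT // card_gt0.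
case: e_tree => _ /card_gt0P[v _] _ _.
have [ex _] := transversal_componentsP _ (adj_of_edges_sym _) tr.
by have [r rS _] := ex v; apply/set0Pn; exists r.
Qed.

End RootedForests.

(** * Minimal trees are greedy *)

Section MinimalIsGreedy.
Variables (R : realFieldType) (x : R) (x_gt0 : 0 < x) (V : finType).
Implicit Types e : rel V.

(** Competitors share the vertex type; trees on other types are compared through their isomorphisms
    with the greedy tree. *)
Definition minimal_tree e : Prop := is_tree e /\
  forall e' : rel V, is_tree e' -> degree_sequence e' = degree_sequence e ->
  wforests x e set0 <= wforests x e' set0.

Lemma minimal_tree_exists e0 : is_tree e0 ->
  exists2 e, minimal_tree e & degree_sequence e = degree_sequence e0.
Proof.
(* Coding relations as sets of pairs gives a finite type to minimize over. *)
move=> t0; pose of_set (A : {set V * V}) : rel V := fun u v => (u, v) \in A.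
have of_setK e : of_set [set p | e p.1 p.2] = e.
  by apply: funext => u; apply: funext => v; rewrite /of_set inE.
pose P (A : {set V * V}) :=
  `[< is_tree (of_set A) /\ degree_sequence (of_set A) = degree_sequence e0 >].
have P0 : P [set p | e0 p.1 p.2] by apply/asboolP; rewrite of_setK.
have [A /asboolP[tA dA] Amin] := arg_minP (fun A => wforests x (of_set A) set0) P0.
exists (of_set A) => //; split=> // e' t' d'.
have := Amin [set p | e' p.1 p.2]; rewrite of_setK; apply.
by apply/asboolP; rewrite of_setK d' dA.
Qed.

Lemma minimal_tree_greedy e : minimal_tree e ->
  graph_iso e (greedy_tree (degree_sequence e)).
Proof.
move=> [et emin].
have [[es ei] /card_gt0P[r0 _] _ ea] := et.
have [r _ rmin] := arg_minP (fun v =>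
  wforests x e [set v]) (erefl true : xpredT r0).
have [par rt E] := tree_rooted ei ea r et; rewrite E.
apply: (@bfs_greedy_iso _ _ par r (fun v => wforests x e [set v]) rt).
- move=> a b ba; apply: (minimal_ancestor x_gt0 et emin rt E) => // v.
  exact: rmin.
- move=> u w a b uw pa au pb bw wa ub le.
  (* The walk through the root [r] avoids [c], which is an ancestor of neither end. *)
  have av c y y' : ~~ fconnect par y c -> ~~ fconnect par y' c -> connect (avoid e
    c) y y'.
    move=> yc y'c; rewrite E; apply: (@connect_trans _ _ r).
      by apply: (avoid_par rt (proj2 rt y)); apply: contra yc => /andP[].
    rewrite (sym_connect_sym (avoid_sym (@par_rel_sym _ par) _)).
    by apply: (avoid_par rt (proj2 rt y')); apply: contra y'c => /andP[].
  have up y c : par c = y -> c != y -> ~~ fconnect par y c.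
    move=> py cy; apply: contra cy => yc.
    by rewrite (fconnect_anti rt _ yc) // -py fconnect1.
  have adj y c : par c = y -> c != y -> e y c.
    by move=> py cy; rewrite E /par_rel eq_sym cy py eqxx orbT.
  have [] // := minimal_swap x_gt0 et emin uw (adj _ _ pa au) (adj _ _ pb bw) _ _
    le.
    by apply: av => //; apply: up.
  by apply: av => //; apply: up.
by rewrite -E => u w; apply: minimal_degree.
Qed.

End MinimalIsGreedy.

(** * Invariance under isomorphism *)

Section Isomorphism.
Variables (V W : finType) (e : rel V) (e' : rel W).
Variables (f : V -> W) (g : W -> V).
Hypotheses (fK : cancel f g) (gK : cancel g f).
Hypothesis fe : forall x y, e' (f x) (f y) = e x y.

Let ge x y : e (g x) (g y) = e' x y. Proof. by rewrite -fe !gK. Qed.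

Lemma iso_degree v : degree e' (f v) = degree e v.
Proof.
rewrite /degree -(card_imset _ (can_inj fK)); apply: eq_card => y.
rewrite inE -{1}[y]gK fe; apply/idP/imsetP => [vy|[t]].
  by exists (g y); rewrite ?inE ?gK.
by rewrite inE => vt ->; rewrite fK.
Qed.

Lemma iso_tree : is_tree e -> is_tree e'.
Proof.
move=> [[es ei] /card_gt0P[v _] ec ea]; split.
- by split; [move=> x y; rewrite -(ge x) -(ge y) es|move=> x; rewrite -ge ei].
- by apply/card_gt0P; exists (f v).
- move=> x y; have /connectP[p pp lp] := ec (g x) (g y); apply/connectP.
  exists (map f p); last by rewrite -[x]gK last_map -lp gK.
  by rewrite -[x]gK; apply: homo_path pp => a b; rewrite fe.
move=> c sc; have := ea (map g c); rewrite size_map => /(_ sc); apply: contra.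
rewrite /ucycleb map_inj_uniq; last exact: can_inj gK.
case/andP=> cc ->; rewrite andbT.
by apply: homo_cycle cc => a b; rewrite ge.
Qed.

Lemma iso_wforests (R : realFieldType) (x : R) :
  wforests x e' set0 = wforests x e set0.
Proof.
pose F (h : {ffun V -> option V}) : {ffun W -> option W} := [ffun w =>
  omap f (h (g w))].
pose G (h : {ffun W -> option W}) : {ffun V -> option V} := [ffun w =>
  omap g (h (f w))].
have FK : cancel F G by move=> h; apply/ffunP => v; rewrite !ffunE fK;
  case: (h v) => //= t; rewrite fK.
have GK : cancel G F by move=> h; apply/ffunP => v; rewrite !ffunE gK;
  case: (h v) => //= t; rewrite gK.
rewrite /wforests (reindex F); last by exists G => h _; [apply: FK|apply: GK].
apply: eq_big => [h|h _].
  rewrite !sub0set !andbT; apply/valid_parentsP/valid_parentsP => H v y.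
    move=> hv; have := H (f v) (f y); rewrite !ffunE !fK hv fe => /(_ erefl)[-> Hy].
    by split=> //; apply: contra Hy => /eqP->.
  rewrite ffunE; case hv: (h (g v)) => [t|] //= [<-]; have [ge' ht] := H _ _ hv.
  rewrite -ge fK; split=> //; rewrite ffunE fK; apply: contra ht.
  by case: (h t) => //= t' /eqP[<-]; rewrite fK.
congr (_ ^+ _); rewrite !setD0 -(card_imset _ (can_inj fK)); apply: eq_card => w.
rewrite inE ffunE; apply/idP/imsetP => [hw|[v]].
  by exists (g w); rewrite ?gK // inE; case: (h (g w)) hw.
by rewrite inE => /eqP hv ->; rewrite fK hv.
Qed.

End Isomorphism.

Theorem theorem2p11 (R : realType) (D : seq nat)
    (hD : tree_degree_sequence D) :
  (forall (V : finType) (e : rel V), is_tree e -> degree_sequence e = D ->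
     forall x : R, 0 < x ->
       rf e x >= rf (greedy_tree D) x /\
       (rf e x = rf (greedy_tree D) x <->
        graph_iso e (greedy_tree D)))
  /\
  [/\ is_tree (greedy_tree D),
      degree_sequence (greedy_tree D) = D
    & forall (V : finType) (e : rel V), is_tree e -> degree_sequence e = D ->
        rf (greedy_tree D) (1 : R) <= rf e 1].
Proof.
(* Both facts are inherited from a minimal tree through its isomorphism with the greedy one, without
   analysing the construction; the choice of 1 as the positive weight is arbitrary. *)
have [gt gd] : is_tree (greedy_tree D) /\ degree_sequence (greedy_tree D) = D.
  case: hD => V [e [te dD]].
  have [m mm md] := minimal_tree_exists (1 : R) te.
  have := minimal_tree_greedy ltr01 mm; rewrite md dD => -[f [[g fK gK] fe]].
  split; first exact: (iso_tree gK fe (proj1 mm)).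
  transitivity (degree_sequence m); last by rewrite md.
  by apply: (degree_sequence_bij (f := f)); [exists g|apply: iso_degree].
have rf_iso (V : finType) (e : rel V) (x : R) :
    is_tree e -> graph_iso e (greedy_tree D) -> rf e x = rf (greedy_tree D) x.
  move=> te [f [[g fK gK] fe]].
  by rewrite !rf_wforests // (iso_wforests fK gK fe).
have main (V : finType) (e : rel V) :
  is_tree e -> degree_sequence e = D -> forall x : R, 0 < x ->
    rf (greedy_tree D) x <= rf e x /\
    (rf e x = rf (greedy_tree D) x <-> graph_iso e (greedy_tree D)).
  move=> te dD x x0; have [m mm md] := minimal_tree_exists x te.
  have mg := minimal_tree_greedy x0 mm; rewrite md dD in mg.
  have rm := rf_iso _ _ x (proj1 mm) mg.
  have le : rf m x <= rf e x by rewrite !rf_wforests //;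
    [apply: (proj2 mm)|case: mm].
  split; first by rewrite -rm.
  (* Equality makes [e] itself a minimal tree, hence greedy. *)
  split=> [E|]; last exact: rf_iso.
  rewrite -dD; apply: (minimal_tree_greedy x0); split=> // e' te' de'.
  rewrite -!rf_wforests // E -rm !rf_wforests //; last by case: mm.
  by apply: (proj2 mm) => //; rewrite de' md.
split; first exact: main.
split=> // V e te dD; by have [] := main V e te dD 1 ltr01.
Qed.
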